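(* The unordered pairs $\{G,H\}$ of non-isomorphic oriented graphs (considered up to isomorphism) whose underlying undirected graphs have maximum degree at most $2$ and which have the same deck are exactly the following (notation $P(\cdot)$, $C(\cdot)$ as in the context; $K_1$ is an isolated vertex, $2K_1$ two isolated vertices, $\vec K_2$ an isolated (directed) edge, and $\sqcup$ denotes disjoint union). 1. Any two of the three graphs $P(++)\sqcup K_1$, $P(+-)\sqcup K_1$, $P(-+)\sqcup K_1$. 2. The pair $P(+++)$, $P(+-+)$; and the pair $P(++-)$, $P(--+)$. 3. The pair $C(+++)\sqcup K_1$, $C(++-)\sqcup K_1$. 4. The pair $C(++++)$, $C(+-+-)$. 5. The pair $A\sqcup S$, $B\sqcup S$, where $S\in\{2K_1,\vec K_2\}$ and $\{A,B\}$ is one of the three pairs $\{C(+++---),\,C(+++++-)\}$, $\{C(-++-++),\,C(-+-+++)\}$, $\{C(++-+--),\,C(++--+-)\}$. 6. The pair $C(+++-+--)\sqcup K_1$, $C(+++--+-)\sqcup K_1$. 7. Any two distinct members of one of the following six families of 8-cycles: (i) $C(+++++++-)$, $C(+++++---)$; (ii) $C(+++-+-+-)$, $C(++-++-+-)$; (iii) $C(++--+-+-)$, $C(++-+-+--)$; (iv) $C(+++--+--)$, $C(+++++-+-)$; (v) $C(++++-++-)$, $C(+++---+-)$, $C(+++-+---)$; (vi) $C(++++-+--)$, $C(++++--+-)$, $C(+++--++-)$, $C(+++-++--)$. 8. The pair $P(+++)\sqcup P(+-+)$, $P(+--)\sqcup P(--+)$. 9. The pair $C(++++)\sqcup C(+-+-)$,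 $C(++--)\sqcup C(++--)$. In summary, calling a family a maximal set (of size at least 2) of pairwise non-isomorphic such oriented graphs all having the same deck: on 4 vertices there are 4 families of size 2 and 1 family of size 3; on 8 vertices there are 13 families of size 2, 1 family of size 3, and 1 family of size 4; and there are no other families.
   Context: All graphs are finite. An oriented graph is a digraph without loops, parallel edges, or directed 2-cycles. For a digraph $G$ and a vertex $v$, $G_v$ denotes the digraph equal to $G$ except that the direction of every edge incident with $v$ is reversed. $\langle G\rangle$ denotes the isomorphism class of $G$. The deck of a digraph $G$ with vertex set $V$ is the multiset $\{\langle G_v\rangle : v\in V\}$. Notation for oriented paths and cycles: for a word $s_1s_2\cdots s_{k}$ in the letters $+,-$, $P(s_1\cdots s_k)$ is the oriented path on vertices $v_1,\dots,v_{k+1}$ with exactly one edge between $v_i$ and $v_{i+1}$ for $1\le i\le k$, directed $v_i\to v_{i+1}$ if $s_i=+$ and $v_{i+1}\to v_i$ if $s_i=-$. For $k\ge 3$, $C(s_1\cdots s_k)$ is the oriented cycle on vertices $v_1,\dots,v_k$ (indices modulo $k$) with exactly one edge between $v_i$ and $v_{i+1}$ for $1\le i\le k$, directed $v_i\to v_{i+1}$ if $s_i=+$ and $v_{i+1}\to v_i$ if $s_i=-$. *)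

(* Defs.v *)
From Stdlib Require List.
From Corelib Require Import Byte.
From mathcomp Require Import all_boot.

Set Implicit Arguments.
Unset Strict Implicit.
Unset Printing Implicit Defensive.

Declare Scope digraph_scope.
Delimit Scope digraph_scope with digraph.

(* Parallel edges are excluded by the representation of edges as a relation. *)
Record digraph := Digraph { vertex :> finType; edge : rel vertex }.

Arguments edge : clear implicits.
Bind Scope digraph_scope with digraph.

Definition oriented (G : digraph) : Prop :=
  forall x y : G, edge G x y -> x != y /\ ~~ edge G y x.

Definition degree (G : digraph) (v : G) : nat :=
  #|[set w : G | edge G v w || edge G w v]|.

Definition max_degree (G : digraph) : nat := \max_(v : G) degree v.

Definition admissible (G : digraph) : Prop := oriented G /\ max_degree G <= 2.

Definition iso (G H : digraph) : bool :=
  [exists f : {ffun G -> H}, exists g : {ffun H -> G},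
    [&& [forall x, g (f x) == x], [forall y, f (g y) == y]
      & [forall x, forall y, edge H (f x) (f y) == edge G x y]]].

Lemma isoP (G H : digraph) :
  reflect (exists f : G -> H,
             bijective f /\ forall x y, edge H (f x) (f y) = edge G x y)
          (iso G H).
Proof.
apply: (iffP existsP) => [[f /existsP[g /and3P[/forallP fK /forallP gK]]]|].
  move=> /forallP edgef; exists f; split=> [|x y].
    by exists g => x; apply/eqP.
  by apply/eqP; move: y; apply/forallP.
case=> f [[g fK gK] edgef]; exists (finfun f); apply/existsP.
exists (finfun g); apply/and3P; split; apply/forallP => x.
- by rewrite !ffunE fK.
- by rewrite !ffunE gK.
- by apply/forallP => y; rewrite !ffunE edgef.
Qed.

Definition switch (G : digraph) (v : G) : digraph :=
  @Digraph G (fun x y => if (x == v) || (y == v) then edge G y x else edge G x y).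

(* A multiset of isomorphism classes is given by its multiplicity function:   *)
(* deck_mult G K is the multiplicity of the class of K in the deck of G.      *)
Definition deck_mult (G K : digraph) : nat :=
  #|[set v : G | iso (switch v) K]|.

Definition same_deck (G H : digraph) : Prop :=
  forall K : digraph, deck_mult G K = deck_mult H K.

Variant sign := Plus | Minus.
Record word := Word { letters : seq sign }.

Fixpoint signs_of_bytes (l : seq byte) : option (seq sign) :=
  match l with
  | nil => Some nil
  | x2b :: l' => omap (cons Plus) (signs_of_bytes l')
  | x2d :: l' => omap (cons Minus) (signs_of_bytes l')
  | _ => None
  end%byte.

Definition word_of_bytes (l : seq byte) : option word :=
  omap Word (signs_of_bytes l).

Definition bytes_of_word (w : word) : seq byte :=
  [seq if s is Plus then x2b else x2d | s <- letters w]%byte.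

(* Words are written as strings: "++-" is Word [:: Plus; Plus; Minus].        *)
Declare Scope word_scope.
Delimit Scope word_scope with word.
Bind Scope word_scope with word.
String Notation word word_of_bytes bytes_of_word : word_scope.

(* The letter number i, counting from 0. *)
Definition is_plus (w : word) (i : nat) : bool :=
  if nth Minus (letters w) i is Plus then true else false.

Definition P (w : word) : digraph :=
  @Digraph 'I_(size (letters w)).+1
    (fun i j => (j == i.+1 :> nat) && is_plus w i
             || (i == j.+1 :> nat) && ~~ is_plus w j).

(* ordS is the successor modulo the length; C w is meant for words of length  *)
(* at least 3.                                                                *)
Definition C (w : word) : digraph :=
  @Digraph 'I_(size (letters w))
    (fun i j => (j == ordS i) && is_plus w i || (i == ordS j) && ~~ is_plus w j).

Definition union (G H : digraph) : digraph :=
  @Digraph (G + H)%type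
    (fun u v => match u, v with
                | inl x, inl y => edge G x y
                | inr x, inr y => edge H x y
                | _, _ => false
                end).

Notation "G ⊔ H" := (union G H)
  (at level 50, left associativity) : digraph_scope.

Definition K1 : digraph := P "".
Definition K2 : digraph := P "+".

Local Open Scope digraph_scope.

(* Each entry stands for all the pairs of distinct members of that entry. *)
Definition table : seq (seq digraph) :=
  [:: [:: P "++" ⊔ K1; P "+-" ⊔ K1; P "-+" ⊔ K1];
      [:: P "+++"; P "+-+"];
      [:: P "++-"; P "--+"];
      [:: C "+++" ⊔ K1; C "++-" ⊔ K1];
      [:: C "++++"; C "+-+-"]]
  ++ [seq [:: AB.1 ⊔ T; AB.2 ⊔ T]
     | AB <- [:: (C "+++---", C "+++++-");
                 (C "-++-++", C "-+-+++");
                 (C "++-+--", C "++--+-")],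
       T <- [:: K1 ⊔ K1; K2]]
  ++ [:: [:: C "+++-+--" ⊔ K1; C "+++--+-" ⊔ K1];
         [:: C "+++++++-"; C "+++++---"];
         [:: C "+++-+-+-"; C "++-++-+-"];
         [:: C "++--+-+-"; C "++-+-+--"];
         [:: C "+++--+--"; C "+++++-+-"];
         [:: C "++++-++-"; C "+++---+-"; C "+++-+---"];
         [:: C "++++-+--"; C "++++--+-"; C "+++--++-"; C "+++-++--"];
         [:: P "+++" ⊔ P "+-+"; P "+--" ⊔ P "--+"];
         [:: C "++++" ⊔ C "+-+-"; C "++--" ⊔ C "++--"]].

Definition listed (G H : digraph) : Prop :=
  exists F : seq digraph, List.In F table /\
  exists i j : nat, [/\ i < size F, j < size F, i != j,
                        iso G (nth K1 F i) & iso H (nth K1 F j)].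

(* Sets of isomorphism classes of digraphs are represented by predicates on   *)
(* digraphs that are closed under isomorphism, compared extensionally.        *)
Definition sub_class (F F' : digraph -> Prop) : Prop := forall G, F G -> F' G.

Definition eq_class (F F' : digraph -> Prop) : Prop := forall G, F G <-> F' G.

Record same_deck_class (F : digraph -> Prop) : Prop := SameDeckClass {
  class_iso : forall G H, F G -> iso G H -> F H;
  class_admissible : forall G, F G -> admissible G;
  class_same_deck : forall G H, F G -> F H -> same_deck G H;
  class_nontrivial : exists G H, [/\ F G, F H & ~~ iso G H]
}.

Definition deck_family (F : digraph -> Prop) : Prop :=
  same_deck_class F /\
  forall F', same_deck_class F' -> sub_class F F' -> sub_class F' F.

Definition on_vertices (n : nat) (F : digraph -> Prop) : Prop :=
  forall G, F G -> #|G| = n.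

Definition class_size (k : nat) (F : digraph -> Prop) : Prop :=
  exists g : 'I_k -> digraph,
    (forall i j, iso (g i) (g j) -> i = j) /\
    (forall G, F G <-> exists i, iso (g i) G).

Definition family_of (n k : nat) (F : digraph -> Prop) : Prop :=
  [/\ deck_family F, on_vertices n F & class_size k F].

Definition number_of_families (n k m : nat) : Prop :=
  exists Fs : 'I_m -> digraph -> Prop,
    [/\ forall i, family_of n k (Fs i),
        forall i j, eq_class (Fs i) (Fs j) -> i = j
      & forall F, family_of n k F -> exists i, eq_class F (Fs i)].

(* Main.v *)
(* Switching all vertices of G one at a time and forgetting labels is a          *)
(* derivation on commutative monomials in isomorphism types of connected         *)
(* digraphs.  Comparing, for a component c of multiplicity k in the common part  *)
(* R of G and H, the elements of the two decks that contain c exactly k - 1      *)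
(* times shows that every component of R is switching-stable.  A single deck     *)
(* equality G_v = H_w shows that G and H differ in at most two components.       *)
(*   If they differ in two, then R is empty and the switching class of each      *)
(* component has at most four isomorphism types, which bounds its order by 6.    *)
(* If they differ in one, G = R + A and H = R + B, then D = A - B satisfies      *)
(* T D = - r D, where T is the sum of all m switchings and r the order of R.     *)
(* Then D is also an eigenvector of the sum over all vertex sets S of i^|S|      *)
(* times the switching of S, because that sum is a polynomial in T, and the      *)
(* square of this operator is (2 i)^m.  So its eigenvalue has modulus 2^(m/2),   *)
(* while its coefficients count the sets S that bring A or B back to A: at most  *)
(* 4 m for each.  Hence 2^m <= (8 m)^2 and m <= 13, and a finite search ends     *)
(* the proof.                                                                    *)

Require Import Defs.
From mathcomp Require Import all_boot all_order all_algebra all_field ring zify.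

Set Implicit Arguments.
Unset Strict Implicit.
Unset Printing Implicit Defensive.

Import Order.TTheory GRing.Theory Num.Theory.

(** A digraph of maximum degree at most 2 is a disjoint union of paths and cycles. Each component is
    a necklace: a cyclic word whose letters are the directions of its edges, with one gap if it is a
    path. Necklaces are isomorphic exactly when their words agree up to rotation and reflection
    ([iso_dihedral]), so the least word names the component, and an admissible digraph becomes a
    multiset of canonical words ([admissible_realization], [realize_iso]). Switching a vertex alters
    one word only, so decks obey a Leibniz rule on multisets.

    Let two different multisets have the same deck, and cancel their common part R. Comparing single
    cards and suitable counts ([same_deck_cases]) leaves either one component a against one
    component b, with every component of R fixed by all its switchings, or two components against
    two with R empty.

    In the first case a - b is an eigenvector of the sum of the m single switchings s_v. These are
    commuting involutions whose product is the identity, so the product of the factors 1 + i s_v has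
    square (2i)^m. It is a polynomial in the sum of the s_v, hence acts on a - b by a scalar of
    modulus 2^(m/2). That scalar is also a difference of two sums of powers of i, one term for each
    vertex set whose switching yields a ([switching_bound]). A switched word determines the set up
    to complement, so each sum has at most 4m terms ([card_switch_set_iso]), which forces m <= 13.

    In the second case the four components are closed under switching, which forces m <= 6
    ([two_component_small]). Exhaustive computation ([check_sizes], [check_quadruplesT]) shows that
    all remaining pairs are in the table, and [table_decks] gives the converse. Each row of the
    table is then a complete deck class, which yields the families. *)

(** * Isomorphisms and switching at a set of vertices *)

Lemma isoI (G H : digraph) (f : G -> H) :
  bijective f -> (forall x y, edge H (f x) (f y) = edge G x y) -> iso G H.
Proof. by move=> bijf edgef; apply/isoP; exists f. Qed.

Lemma iso_edges (T : finType) (e e' : rel T) :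
  e =2 e' -> iso (Digraph e) (Digraph e').
Proof. by move=> eqe; apply: (@isoI (Digraph e) (Digraph e') id); first exists id. Qed.

Lemma iso_refl (G : digraph) : iso G G.
Proof. by apply: (@isoI G G id); first exists id. Qed.

Lemma iso_sym_imp (G H : digraph) : iso G H -> iso H G.
Proof.
case/isoP=> f [[g fK gK] edgef]; apply: (@isoI H G g); first by exists f.
by move=> x y; rewrite -edgef !gK.
Qed.

Lemma iso_sym (G H : digraph) : iso G H = iso H G.
Proof. by apply/idP/idP; apply: iso_sym_imp. Qed.

Lemma iso_trans (H G K : digraph) : iso G H -> iso H K -> iso G K.
Proof.
case/isoP=> f [bijf edgef] /isoP[g [bijg edgeg]].
apply: (@isoI G K (g \o f)); first exact: bij_comp.
by move=> x y; rewrite /= edgeg edgef.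
Qed.

Lemma iso_congr (G G' H H' : digraph) : iso G G' -> iso H H' -> iso G H = iso G' H'.
Proof.
move=> gg hh; apply/idP/idP => i.
  by apply: (iso_trans _ hh); apply: (iso_trans _ i); rewrite iso_sym.
by apply: (iso_trans gg); apply: (iso_trans i); rewrite iso_sym.
Qed.

Lemma iso_card (G H : digraph) : iso G H -> #|G| = #|H|.
Proof. by case/isoP=> f [bijf _]; apply: bij_eq_card bijf. Qed.

(** Invariant functions serve as linear functionals: an identity between formal combinations of
    isomorphism classes is stated by testing it against every such [psi], so the quotient is never
    formed. *)
Definition iso_invariant T (psi : digraph -> T) : Prop :=
  forall G H, iso G H -> psi G = psi H.

Definition symdiff (T : finType) (A B : {set T}) : {set T} :=
  [set x | (x \in A) (+) (x \in B)].

Lemma symdiffK (T : finType) (B : {set T}) : involutive (fun A => symdiff A B).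
Proof. by move=> A; apply/setP=> x; rewrite !inE -addbA addbb addbF. Qed.

Lemma symdiffKl (T : finType) (B : {set T}) : involutive (symdiff B).
Proof. by move=> A; apply/setP=> x; rewrite !inE addbA addbb addFb. Qed.

Lemma symdiff1 (T : finType) (A : {set T}) v :
  symdiff A [set v] = if v \in A then A :\ v else v |: A.
Proof.
by apply/setP=> x; case: ifP => vA; rewrite !inE; case: eqVneq => [->|_];
   rewrite ?vA ?addbF ?addbT ?orbF.
Qed.

Lemma card_symdiff1 (T : finType) (A : {set T}) v :
  #|symdiff A [set v]| = if v \in A then #|A|.-1 else #|A|.+1.
Proof.
rewrite symdiff1; case: ifP => vA; last by rewrite cardsU1 vA.
by rewrite (cardsD1 v A) vA.
Qed.

(** Switching the vertices of S in turn reverses an edge once for each endpoint in S, so only the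
    parity matters. The subsets act as a group under symmetric difference. *)
Definition switch_set (G : digraph) (S : {set G}) : digraph :=
  @Digraph G (fun x y => if (x \in S) (+) (y \in S) then edge G y x else edge G x y).

Lemma switch_set0 (G : digraph) : iso (switch_set (set0 : {set G})) G.
Proof. by apply: iso_edges => x y; rewrite !inE. Qed.

Lemma switch_setT (G : digraph) : iso (switch_set [set: G]) G.
Proof. by apply: iso_edges => x y; rewrite !inE. Qed.

(** The disjunction in [switch] and the exclusive or in [switch_set] differ only at a loop, which
    reversal does not change. *)
Lemma switch_set1 (G : digraph) (v : G) : iso (switch v) (switch_set [set v]).
Proof.
apply: iso_edges => x y; rewrite /= !inE.
by case: eqVneq => [->|_]; case: eqVneq => [->|_].
Qed.

Lemma switch_set_comp (G : digraph) (S U : {set G}) :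
  iso (@switch_set (switch_set S) U) (switch_set (symdiff S U)).
Proof.
apply: iso_edges => x y; rewrite /= !inE.
by do 4?case: (_ \in _).
Qed.

Lemma switch_switch_set (G : digraph) (S : {set G}) (v : G) :
  iso (@switch (switch_set S) v) (switch_set (symdiff S [set v])).
Proof. exact: iso_trans (@switch_set1 (switch_set S) v) (switch_set_comp S [set v]). Qed.

Lemma switch_set_switch (G : digraph) (S : {set G}) (v : G) :
  iso (@switch_set (switch v) S) (switch_set (symdiff S [set v])).
Proof.
apply: iso_edges => x y; rewrite /= !inE.
by case: (eqVneq x v) => [->|_]; case: (eqVneq y v) => [->|_];
   do 2?case: (_ \in S).
Qed.

Lemma iso_switch_set (G H : digraph) (f : G -> H) (S : {set G}) :
  bijective f -> (forall x y, edge H (f x) (f y) = edge G x y) ->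
  iso (switch_set S) (switch_set (f @: S)).
Proof.
move=> bijf edgef.
apply: (@isoI (switch_set S) (switch_set (f @: S)) f) => // x y /=.
by rewrite !(mem_imset _ _ (bij_inj bijf)) !edgef.
Qed.

Lemma iso_switch (G H : digraph) (f : G -> H) (v : G) :
  bijective f -> (forall x y, edge H (f x) (f y) = edge G x y) ->
  iso (switch v) (switch (f v)).
Proof.
move=> bijf edgef; apply: (@isoI (switch v) (switch (f v)) f) => // x y /=.
by rewrite !edgef !(inj_eq (bij_inj bijf)).
Qed.

(** * Switching operators and the eigenvalue bound *)

Section SwitchingOperators.
Local Open Scope ring_scope.

(** The k-th elementary symmetric function of the single switchings, acting on functions. *)
Definition layer (k : nat) (psi : digraph -> algC) (G : digraph) : algC :=
  \sum_(S : {set G} | #|S| == k) psi (switch_set S).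

(** The product over all vertices v of 1 + i s_v, with s_v the switching of v. Since s_v is an
    involution, each factor has square 2 i s_v; and the product of all s_v is the identity. *)
Definition quarter (psi : digraph -> algC) (G : digraph) : algC :=
  \sum_(S : {set G}) 'i ^+ #|S| * psi (switch_set S).

Lemma sum_switch_set_iso (F : nat -> digraph -> algC) (G H : digraph) :
  (forall k, iso_invariant (F k)) -> iso G H ->
  \sum_(S : {set G}) F #|S| (switch_set S) = \sum_(S : {set H}) F #|S| (switch_set S).
Proof.
move=> invF /isoP[f [bijf edgef]].
have [g fK gK] := bijf.
rewrite (reindex (fun S : {set G} => f @: S)) /=; last first.
  exists (fun U : {set H} => g @: U) => U _.
    by rewrite -imset_comp (eq_imset _ (_ : _ =1 id)) ?imset_id.
  by rewrite -imset_comp (eq_imset _ (_ : _ =1 id)) ?imset_id.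
apply: eq_bigr => S _; rewrite (card_imset _ (bij_inj bijf)).
by apply: invF; apply: iso_switch_set.
Qed.

Lemma layer_iso k psi : iso_invariant psi -> iso_invariant (layer k psi).
Proof.
move=> inv G H isoGH; rewrite /layer big_mkcond [RHS]big_mkcond.
apply: (@sum_switch_set_iso (fun j K => if j == k then psi K else 0)) => // j K K' iK.
by rewrite (inv _ _ iK).
Qed.

Lemma quarter_iso psi : iso_invariant psi -> iso_invariant (quarter psi).
Proof.
move=> inv G H; apply: (@sum_switch_set_iso (fun j K => 'i ^+ j * psi K)).
by move=> j K K' iK; rewrite (inv _ _ iK).
Qed.

Lemma layer0 psi (G : digraph) : iso_invariant psi -> layer 0 psi G = psi G.
Proof.
move=> inv; rewrite /layer (big_pred1 set0) => [|S]; last by rewrite cards_eq0.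
exact/inv/switch_set0.
Qed.

Lemma quarterE psi (G : digraph) :
  quarter psi G = \sum_(k < #|G|.+1) 'i ^+ k * layer k psi G.
Proof.
rewrite /quarter (partition_big (fun S : {set G} => inord #|S| : 'I_#|G|.+1) xpredT) //.
apply: eq_bigr => k _; rewrite /layer big_distrr /=.
have E (S : {set G}) : (inord #|S| == k :> 'I_#|G|.+1) = (#|S| == k :> nat).
  by rewrite -val_eqE /= inordK // ltnS max_card.
by under eq_bigl => S do rewrite E; apply: eq_bigr => S /eqP <-.
Qed.

Lemma card_symdiff1_eq (T : finType) (U : {set T}) k :
  #|[set v | #|symdiff U [set v]| == k]| =
    ((#|U| == k.+1) * k.+1 + (#|U|.+1 == k) * (#|T| - #|U|))%N.
Proof.
rewrite -(cardsID U [set v | _]).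
have -> : [set v | #|symdiff U [set v]| == k] :&: U = [set v in U | #|U| == k.+1].
  apply/setP=> v; rewrite !inE card_symdiff1 andbC; case vU: (v \in U) => //=.
  by have -> : #|U| = #|U|.-1.+1 by rewrite prednK //; apply/card_gt0P; exists v.
have -> : [set v | #|symdiff U [set v]| == k] :\: U = [set v in ~: U | #|U|.+1 == k].
  by apply/setP=> v; rewrite !inE card_symdiff1; case: (v \in U).
congr addn.
  case: eqP => [<-|_]; last by rewrite mul0n; apply: eq_card0 => v; rewrite !inE andbF.
  by rewrite mul1n; apply: eq_card => v; rewrite !inE andbT.
case: eqP => [_|_]; last by rewrite mul0n; apply: eq_card0 => v; rewrite !inE andbF.
by rewrite mul1n -(cardsC U) addKn; apply: eq_card => v; rewrite !inE andbT.
Qed.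

(** Toggling one vertex of a set moves its size up or down by one, whence a three-term recurrence.
    It makes every [layer] a polynomial in the sum of the single switchings. *)
Lemma sum_layer_switch k psi (G : digraph) : iso_invariant psi ->
  \sum_(v : G) layer k psi (switch v) =
    k.+1%:R * layer k.+1 psi G +
    (if k is k'.+1 then (#|G| - k')%:R * layer k' psi G else 0).
Proof.
move=> inv.
transitivity (\sum_(v : G) \sum_(U : {set G} | #|symdiff U [set v]| == k)
                 psi (switch_set U)).
  apply: eq_bigr => v _; rewrite /layer.
  rewrite (reindex_inj (can_inj (symdiffK [set v]))) /=.
  apply: eq_bigr => U _; apply: inv; apply: iso_trans (switch_set_switch _ _) _.
  by rewrite (symdiffK [set v] U); apply: iso_refl.
rewrite (exchange_big_dep xpredT) //=.
transitivity (\sum_(U : {set G}) (((#|U| == k.+1) * k.+1)%:R * psi (switch_set U)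
    + ((#|U|.+1 == k) * (#|G| - #|U|))%:R * psi (switch_set U))).
  apply: eq_bigr => U _; rewrite sumr_const -mulrDl -natrD -card_symdiff1_eq.
  by rewrite mulr_natl; congr (_ *+ _); apply: eq_card => v; rewrite !inE.
rewrite big_split /=; congr (_ + _).
  rewrite /layer big_distrr [RHS]big_mkcond /=; apply: eq_bigr => U _.
  by case: eqP => _; rewrite ?mul1n // mul0n mul0r.
case: k => [|k]; first by rewrite big1 // => U _; rewrite mul0n mul0r.
rewrite /layer big_distrr [RHS]big_mkcond /=; apply: eq_bigr => U _.
by rewrite eqSS; case: eqP => [->|_]; rewrite ?mul1n // mul0n mul0r.
Qed.

(** If v is outside W, toggling v in S changes both exponents by the same unit, so the term changes
    sign and the sum cancels. If W is everything, the exponents add up to the order of T. *)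
Lemma sum_i_pow_symdiff (T : finType) (W : {set T}) :
  \sum_(S : {set T}) 'i ^+ #|S| * 'i ^+ #|symdiff S W| =
    (if W == setT then 2%:R ^+ #|T| * 'i ^+ #|T| else 0 : algC).
Proof.
case: eqP => [->|/eqP WT].
  transitivity (\sum_(S : {set T}) 'i ^+ #|T| : algC).
    apply: eq_bigr => S _; rewrite -exprD; congr (_ ^+ _).
    have -> : symdiff S setT = ~: S by apply/setP=> x; rewrite !inE addbT.
    by rewrite cardsC.
  rewrite sumr_const -[LHS]mulr_natl; congr (_ * _).
  have -> : #|{: {set T}}| = #|powerset [set: T]|.
    by apply: eq_card => S; rewrite !inE subsetT.
  by rewrite card_powerset cardsT natrX.
have [v vW] : exists v, v \notin W.
  apply/existsP; rewrite -negb_forall; apply: contra WT => /forallP H.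
  by apply/eqP/setP=> x; rewrite H inE.
have sgn (S : {set T}) : 'i ^+ #|symdiff S [set v]| * 'i ^+ #|symdiff (symdiff S [set v]) W|
    = - ('i ^+ #|S| * 'i ^+ #|symdiff S W|) :> algC.
  have -> : symdiff (symdiff S [set v]) W = symdiff (symdiff S W) [set v].
    by apply/setP=> x; rewrite !inE -!addbA; congr addb; rewrite addbC.
  rewrite !card_symdiff1 !inE (negPf vW) addbF.
  case: ifP => vS; last by rewrite !exprS mulrACA -expr2 sqrCi mulN1r.
  have S0 : (0 < #|S|)%N by apply/card_gt0P; exists v.
  have SW0 : (0 < #|symdiff S W|)%N.
    by apply/card_gt0P; exists v; rewrite inE (negPf vW) addbF.
  rewrite -[in RHS](prednK S0) -[in RHS](prednK SW0) !exprS.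
  by rewrite mulrACA -expr2 sqrCi mulN1r opprK.
set s := LHS; have : s = - s.
  rewrite {1}/s (reindex_inj (can_inj (symdiffK [set v]))) /= /s -sumrN.
  by apply: eq_bigr => S _; rewrite sgn.
by move/eqP; rewrite -addr_eq0 -mulr2n mulrn_eq0 => /eqP.
Qed.

Lemma quarter_quarter psi (G : digraph) : iso_invariant psi ->
  quarter (quarter psi) G = 2%:R ^+ #|G| * 'i ^+ #|G| * psi G.
Proof.
move=> inv; rewrite {1}/quarter /quarter.
transitivity (\sum_(S : {set G}) \sum_(W : {set G})
    'i ^+ #|S| * 'i ^+ #|symdiff S W| * psi (switch_set W)).
  apply: eq_bigr => S _; rewrite big_distrr /=.
  rewrite (reindex_inj (can_inj (symdiffKl S))) /=.
  apply: eq_bigr => W _; rewrite mulrA; congr (_ * _); apply: inv.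
  by apply: iso_trans (switch_set_comp _ _) _; rewrite (symdiffKl S W); apply: iso_refl.
rewrite exchange_big /=.
under eq_bigr => W _ do rewrite -big_distrl /= sum_i_pow_symdiff.
rewrite (bigD1 setT) //= eqxx big1 ?addr0 => [|W /negPf->]; last by rewrite mul0r.
by congr (_ * _); apply/inv/switch_setT.
Qed.

Lemma eq_of_subr (V : zmodType) (x y a b : V) : a = b -> x - y = a - b -> x = y.
Proof. by move=> ->; rewrite subrr => /eqP; rewrite subr_eq0 => /eqP. Qed.

(** The last hypothesis says that A - B is an eigenvector, of eigenvalue -r, of the sum of all
    single switchings. The eigenvalue [lam] of [quarter] on it is computed twice: from its square,
    and from the indicator of the class of A. *)
Theorem switching_bound (A B : digraph) (r : nat) :
  #|A| = #|B| -> ~~ iso A B ->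
  (forall psi : digraph -> algC, iso_invariant psi ->
     \sum_(v : A) psi (switch v) + r%:R * psi A
     = \sum_(v : B) psi (switch v) + r%:R * psi B) ->
  (2 ^ #|A| <= (#|[set S : {set A} | iso (switch_set S) A]|
              + #|[set S : {set B} | iso (switch_set S) A]|) ^ 2)%N.
Proof.
move=> cardAB nAB deckAB.
have step j psi : iso_invariant psi ->
    j.+1%:R * (layer j.+1 psi A - layer j.+1 psi B) =
    - (r%:R * (layer j psi A - layer j psi B)) -
    (if j is j'.+1 then (#|A| - j')%:R * (layer j' psi A - layer j' psi B) else 0).
  move=> inv; have := deckAB _ (@layer_iso j _ inv).
  rewrite !sum_layer_switch // -cardAB.
  case: j => [|j]; first by rewrite !addr0 subr0 => E; apply: (eq_of_subr E); ring.
  by move: (_ - _)%:R => c E; apply: (eq_of_subr E); ring.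
have step_eigen k c psi : iso_invariant psi ->
    k.+1%:R * (layer k.+1 psi A - layer k.+1 psi B) = c * (psi A - psi B) ->
    layer k.+1 psi A - layer k.+1 psi B = c / k.+1%:R * (psi A - psi B).
  move=> inv E; rewrite mulrAC -E mulrC mulKf //.
  by rewrite pnatr_eq0.
(* Two consecutive scalars are carried along because the recurrence has three terms. *)
have kappa k : exists c : algC * algC, forall psi, iso_invariant psi ->
    layer k psi A - layer k psi B = c.1 * (psi A - psi B) /\
    layer k.+1 psi A - layer k.+1 psi B = c.2 * (psi A - psi B).
  elim: k => [|k [c Hc]].
    exists (1, - r%:R / 1%:R) => psi inv; split; first by rewrite !layer0 ?mul1r.
    apply: step_eigen => //; rewrite (step 0) // !layer0 //.
    by rewrite subr0 mulNr.
  exists (c.2, (- (r%:R * c.2) - (#|A| - k)%:R * c.1) / k.+2%:R) => psi inv.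
  have [E1 E2] := Hc _ inv; split=> //; apply: step_eigen => //.
  by rewrite (step k.+1) // E1 E2; move: (_ - _)%:R => d; ring.
have [lam quarter_lam] : exists lam : algC, forall psi, iso_invariant psi ->
    quarter psi A - quarter psi B = lam * (psi A - psi B).
  suff [c Hc] : exists c : nat -> algC, forall k psi, (k < #|A|.+1)%N -> iso_invariant psi ->
      layer k psi A - layer k psi B = c k * (psi A - psi B).
    exists (\sum_(k < #|A|.+1) 'i ^+ k * c k) => psi inv.
    rewrite !quarterE -cardAB -sumrB big_distrl /=; apply: eq_bigr => k _.
    by rewrite -mulrBr (Hc _ _ (ltn_ord k) inv) mulrA.
  (* The existentials of [kappa] are collected into one function by finitely many successive
     choices. *)
  elim: #|A|.+1 => [|n [c Hc]]; first by exists (fun _ => 0).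
  have [d Hd] := kappa n; exists (fun k => if k == n then d.1 else c k) => k psi ltk inv.
  case: eqP => [->|/eqP kn]; first by case: (Hd _ inv).
  by apply: Hc => //; rewrite ltn_neqAle kn.
(* This functional takes the value 1 on A - B, so it reads off the eigenvalue. *)
pose chi (X : digraph) : algC := (iso X A)%:R.
have chi_inv : iso_invariant chi.
  by move=> X Y XY; rewrite /chi (iso_congr XY (iso_refl A)).
have chiAB : chi A - chi B = 1.
  by rewrite /chi iso_refl iso_sym (negPf nAB) subr0.
have lamE : lam = quarter chi A - quarter chi B by rewrite quarter_lam // chiAB mulr1.
have : lam ^+ 2 = 2%:R ^+ #|A| * 'i ^+ #|A|.
  have := quarter_lam _ (quarter_iso chi_inv).
  rewrite !quarter_quarter // -cardAB -mulrBr chiAB mulr1 => ->.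
  by rewrite quarter_lam // chiAB mulr1 expr2.
move/(congr1 (fun z => `|z|)); rewrite normrX normrM !normrX normCi expr1n mulr1.
rewrite normr_nat => lam2.
have norm_quarter (X : digraph) :
    `|quarter chi X| <= #|[set S : {set X} | iso (switch_set S) A]|%:R.
  apply: le_trans (ler_norm_sum _ _ _) _.
  rewrite -sum1_card natr_sum [leRHS]big_mkcond /=; apply: ler_sum => S _.
  rewrite normrM normrX normCi expr1n mul1r /chi inE.
  by case: (iso _ _); rewrite ?normr1 ?normr0.
rewrite -(ler_nat algC) !natrX -lam2 natrD ler_pXn2r ?nnegrE ?addr_ge0 //.
by rewrite lamE; apply: le_trans (ler_normB _ _) _; apply: lerD.
Qed.

End SwitchingOperators.

(** * Paths and cycles as cyclic words *)

Definition adjacent (G : digraph) : rel G := fun x y => edge G x y || edge G y x.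

(* Cyclic words over {+, -, no edge}: the word of a path ends with None. *)
Definition necklace_fun n (g : 'I_n -> option bool) : digraph :=
  @Digraph 'I_n (fun i j => (j == ordS i) && (g i == Some true)
                         || (i == ordS j) && (g j == Some false)).

Definition necklace (w : seq (option bool)) : digraph :=
  necklace_fun (fun i : 'I_(size w) => nth None w i).

Definition opp_letter (x : option bool) := omap negb x.

Definition backward (w : seq (option bool)) := rev (map opp_letter w).

(** Only the last letter may be a gap, which makes the word a path. A word without gap needs length
    at least 3, since shorter cyclic words would produce loops or double edges. *)
Definition well_formed (w : seq (option bool)) :=
  [&& 0 < size w, all isSome (take (size w).-1 w)
    & (last None w == None) || (2 < size w)].

Definition dihedral (w : seq (option bool)) :=
  [seq rot k w | k <- iota 0 (size w)]
  ++ [seq rot k (backward w) | k <- iota 0 (size w)].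

Lemma opp_letterK : involutive opp_letter.
Proof. by case=> [[]|]. Qed.

Lemma backwardK : involutive backward.
Proof. by move=> w; rewrite /backward map_rev revK mapK //; apply: opp_letterK. Qed.

Lemma size_backward w : size (backward w) = size w.
Proof. by rewrite size_rev size_map. Qed.

Lemma nth_rot (T : Type) (x0 : T) k s i : k <= size s -> i < size s ->
  nth x0 (rot k s) i = nth x0 s ((i + k) %% size s).
Proof.
move=> lek lti; rewrite /rot nth_cat size_drop nth_drop addnC.
case: ltnP => H; first by rewrite modn_small //; lia.
have le : size s <= i + k by lia.
rewrite nth_take; last lia.
by congr nth; rewrite -[in RHS](subnK le) modnDr modn_small; lia.
Qed.

Lemma val_ordS n (i : 'I_n) : ordS i = (if i.+1 == n then 0 else i.+1) :> nat.
Proof.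
have lt := ltn_ord i; case: eqP => [E|ne] /=; first by rewrite E modnn.
by rewrite modn_small //; lia.
Qed.

Lemma val_ord_pred n (i : 'I_n) : ord_pred i = (if i == 0 :> nat then n.-1 else i.-1) :> nat.
Proof.
have lt := ltn_ord i; case: eqP => [E|ne] /=; first by rewrite E add0n modn_small; lia.
have -> : (i + n).-1 = i.-1 + n by lia.
by rewrite modnDr modn_small; lia.
Qed.

Lemma ordS_neq n (i : 'I_n) : 1 < n -> ordS i != i.
Proof.
move=> n1; apply/eqP=> /(congr1 (@nat_of_ord n)); rewrite val_ordS.
by have := ltn_ord i; case: eqP; lia.
Qed.

Lemma ordSS_neq n (i : 'I_n) : 2 < n -> ordS (ordS i) != i.
Proof.
move=> n2; apply/eqP=> /(congr1 (@nat_of_ord n)); rewrite !val_ordS.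
by have := ltn_ord i; case: (i.+1 =P n) => E; case: eqP; lia.
Qed.

Lemma ord_pred_neqS n (i : 'I_n) : 2 < n -> ord_pred i != ordS i.
Proof.
move=> n2; apply: contraNneq (ordSS_neq (ord_pred i) n2) => E.
by rewrite ord_predK -E.
Qed.

Lemma ordS_rev n (i : 'I_n) : ordS (rev_ord (ordS i)) = rev_ord i.
Proof.
have rev_val (j : 'I_n) : rev_ord j = n - j.+1 :> nat by [].
apply: ord_inj; rewrite val_ordS !rev_val val_ordS; have := ltn_ord i.
by case: (i.+1 =P n) => E; case: eqP; lia.
Qed.

Lemma ordS_ind n (p : pred 'I_n) : (forall i, p i -> p (ordS i)) ->
  forall i j, p i -> p j.
Proof.
move=> pS i j pi.
have it k : p (iter k (@ordS n) i) by elim: k => //= k; apply: pS.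
have E k : iter k (@ordS n) i = (i + k) %% n :> nat.
  elim: k => [|k IH] /=; first by rewrite addn0 modn_small.
  by rewrite IH -addn1 modnDml addn1 addnS.
have -> : j = iter (n - i + j) (@ordS n) i; last exact: it.
apply: ord_inj; rewrite E addnA subnKC; last exact: ltnW.
by rewrite modnDl modn_small.
Qed.

(** A change of direction after i would give s (i + 2) = s i, against injectivity as n > 2. Hence
    the direction of one step propagates around the cycle. *)
Lemma cyclic_map n (s : 'I_n -> 'I_n) : 2 < n -> injective s ->
  (forall i, s (ordS i) = ordS (s i) \/ s (ordS i) = ord_pred (s i)) ->
  (forall i, s (ordS i) = ordS (s i)) \/ (forall i, s (ordS i) = ord_pred (s i)).
Proof.
move=> n2 injs adjs; pose p i := s (ordS i) == ordS (s i).
have pS i : p i -> p (ordS i).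
  move/eqP=> E; apply/eqP; case: (adjs (ordS i)) => // /esym.
  by rewrite E ordSK => /injs /esym /eqP; rewrite (negPf (ordSS_neq i n2)).
case: (pickP p) => [i pi|np]; last first.
  by right=> i; case: (adjs i) => // E; have := np i; rewrite /p E eqxx.
by left=> j; apply/eqP; apply: (ordS_ind pS) pi.
Qed.

Lemma necklace_funE n w : size w = n ->
  iso (necklace w) (necklace_fun (fun i : 'I_n => nth None w i)).
Proof. by move=> <-; apply: iso_refl. Qed.

Lemma iso_necklace_rot n (s : 'I_n -> 'I_n) (g h : 'I_n -> option bool) :
  bijective s -> (forall i, s (ordS i) = ordS (s i)) ->
  (forall i, h (s i) = g i) -> iso (necklace_fun g) (necklace_fun h).
Proof.
move=> bijs sS gs; apply: (@isoI (necklace_fun g) (necklace_fun h) s) => // x y /=.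
by rewrite -!sS !(inj_eq (bij_inj bijs)) !gs.
Qed.

Lemma iso_necklace_rev n (s : 'I_n -> 'I_n) (g h : 'I_n -> option bool) :
  bijective s -> (forall i, s (ordS i) = ord_pred (s i)) ->
  (forall i, h (s (ordS i)) = opp_letter (g i)) ->
  iso (necklace_fun g) (necklace_fun h).
Proof.
move=> bijs sS gs; apply: (@isoI (necklace_fun g) (necklace_fun h) s) => // x y /=.
have E a b : (s a == ordS (s b)) = (b == ordS a).
  by rewrite -(inj_eq (@ord_pred_inj n)) ordSK -sS (inj_eq (bij_inj bijs)) eq_sym.
rewrite !E orbC; congr orb; case: eqP => //= ->; rewrite gs; by case: (g _) => [[]|].
Qed.

Lemma iso_rot1 w : iso (necklace w) (necklace (rot 1 w)).
Proof.
case: (posnP (size w)) => [/size0nil->|w0]; first exact: iso_refl.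
have := necklace_funE (size_rot 1 w); rewrite iso_sym; apply: iso_trans.
apply: (@iso_necklace_rot _ (@ord_pred _)) => [|i|i].
- exact: ord_pred_bij.
- by rewrite ordSK ord_predK.
- rewrite nth_rot //; congr nth.
  by rewrite addn1; exact: (congr1 val (ord_predK i)).
Qed.

Lemma iso_rot k w : iso (necklace w) (necklace (rot k w)).
Proof.
elim: k => [|k IH]; first by rewrite rot0; apply: iso_refl.
case: (ltnP k (size w)) => lek; last by rewrite rot_oversize ?iso_refl // ltnW.
by rewrite rotS //; apply: iso_trans IH (iso_rot1 _).
Qed.

Lemma iso_backward w : iso (necklace w) (necklace (backward w)).
Proof.
have := necklace_funE (size_backward w); rewrite iso_sym; apply: iso_trans.
(* Letter i sits on the edge from i to i + 1, so reversing the letters corresponds to the reflection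
   i -> n - i of the vertices; the successor corrects [rev_ord], which is i -> n - 1 - i. *)
apply: (@iso_necklace_rev _ (fun i => ordS (rev_ord i))) => [|i|i].
- by apply: bij_comp (ordS_bij _) _; exists (@rev_ord _); apply: rev_ordK.
- by rewrite ordSK ordS_rev.
- rewrite ordS_rev nth_rev ?size_map /=; last by have := ltn_ord i; lia.
  rewrite (nth_map None); last by have := ltn_ord i; lia.
  by congr (opp_letter (nth _ _ _)); have := ltn_ord i; lia.
Qed.

Lemma dihedralP w u : 0 < size w ->
  reflect (exists k, u = rot k w \/ u = rot k (backward w)) (u \in dihedral w).
Proof.
move=> w0; have E k v : size v = size w -> rot k v \in [seq rot k v | k <- iota 0 (size w)].
  move=> sv; case: (ltnP k (size w)) => lek.
    by apply/mapP; exists k; rewrite ?mem_iota.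
  by apply/mapP; exists 0; rewrite ?mem_iota // rot0 rot_oversize ?sv.
apply: (iffP idP) => [|[k [->|->]]].
- by rewrite mem_cat => /orP[] /mapP[k _ ->]; exists k; [left | right].
- by rewrite mem_cat E.
- by rewrite mem_cat E ?orbT // size_backward.
Qed.

Lemma dihedral_iso w u : u \in dihedral w -> iso (necklace w) (necklace u).
Proof.
rewrite mem_cat => /orP[] /mapP[k _ ->]; first exact: iso_rot.
exact: iso_trans (iso_backward w) (iso_rot _ _).
Qed.

Lemma well_formed_nth w i : well_formed w -> i < (size w).-1 -> nth None w i != None.
Proof.
case/and3P=> w0 /allP all_some _ lti.
have := all_some (nth None w i); rewrite -(@nth_take (size w).-1 _ None i lti).
rewrite mem_nth; last by rewrite size_takel ?leq_pred.
by case: (nth _ _ _) => // /(_ isT).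
Qed.

(** * Isomorphisms of necklaces are rotations and reflections *)

Section Rigidity.
Variables (n : nat) (g h : 'I_n -> option bool).
Hypothesis n2 : 2 < n.
Hypothesis h_some : forall i : 'I_n, i < n.-1 -> h i != None.
Variables (s t : 'I_n -> 'I_n).
Hypotheses (sK : cancel s t) (tK : cancel t s).
Hypothesis edge_s :
  forall x y, edge (necklace_fun h) (s x) (s y) = edge (necklace_fun g) x y.

Lemma edge_ordS (f : 'I_n -> option bool) i :
  (edge (necklace_fun f) i (ordS i) = (f i == Some true)) *
  (edge (necklace_fun f) (ordS i) i = (f i == Some false)).
Proof.
by split; rewrite /= eqxx [i == _]eq_sym (negPf (ordSS_neq i n2)) ?orbF.
Qed.

Lemma adjacentE (f : 'I_n -> option bool) x y :
  adjacent (G := necklace_fun f) x y =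
  (y == ordS x) && (f x != None) || (x == ordS y) && (f y != None).
Proof.
rewrite /adjacent /=.
by case: (y == _); case: (x == _); case: (f x) => [[]|]; case: (f y) => [[]|].
Qed.

Lemma adjacent_s x y :
  adjacent (G := necklace_fun h) (s x) (s y) = adjacent (G := necklace_fun g) x y.
Proof. by rewrite /adjacent !edge_s. Qed.

Lemma deficient_s x : (g x == None) || (g (ord_pred x) == None) ->
  (h (s x) == None) || (h (ord_pred (s x)) == None).
Proof.
apply: contraTT; rewrite !negb_or => /andP[h1 h2].
have A1 : adjacent (G := necklace_fun g) x (t (ordS (s x))).
  by rewrite -adjacent_s tK adjacentE eqxx h1.
have A2 : adjacent (G := necklace_fun g) x (t (ord_pred (s x))).
  by rewrite -adjacent_s tK adjacentE ord_predK eqxx h2 orbT.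
have ne : t (ordS (s x)) != t (ord_pred (s x)).
  by rewrite (inj_eq (can_inj tK)) eq_sym ord_pred_neqS.
move: A1 A2 ne; move: (t _) (t _) => y z; rewrite !adjacentE.
case/orP=> /andP[/eqP E1 G1] /orP[] /andP[/eqP E2 G2].
- by rewrite E1 E2 eqxx.
- by move=> _; rewrite G1 E2 ordSK G2.
- by move=> _; rewrite G2 E1 ordSK G1.
- by move: E1; rewrite E2 => /ordS_inj ->; rewrite eqxx.
Qed.

(** Along an edge this is preservation of adjacency. Across a gap of g, both i and i + 1 lack a
    neighbour, hence so do their images; these must be the two ends n - 1 and 0 of h, which are
    cyclically consecutive. *)
Lemma s_cyclic i : s (ordS i) = ordS (s i) \/ s (ordS i) = ord_pred (s i).
Proof.
have [gi|gi] := eqVneq (g i) None; last first.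
  have : adjacent (G := necklace_fun h) (s i) (s (ordS i)).
    by rewrite adjacent_s adjacentE eqxx gi.
  rewrite adjacentE => /orP[] /andP[/eqP E _]; first by left.
  by right; rewrite E ordSK.
have last_h (x : 'I_n) : (h x == None) || (h (ord_pred x) == None) ->
    x = n.-1 :> nat \/ x = 0 :> nat.
  move=> H; have lx := ltn_ord x.
  have h0 (y : 'I_n) : h y == None -> y = n.-1 :> nat.
    move=> hy; apply/eqP; apply: contraTT hy => ny; apply: h_some.
    by have := ltn_ord y; move: ny; lia.
  case/orP: H => /h0; first by left.
  by rewrite val_ord_pred; case: eqP; lia.
have d1 : (h (s i) == None) || (h (ord_pred (s i)) == None).
  by apply: deficient_s; rewrite gi.
have d2 : (h (s (ordS i)) == None) || (h (ord_pred (s (ordS i))) == None).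
  by apply: deficient_s; rewrite ordSK gi orbT.
have ne : s i != s (ordS i).
  by rewrite (inj_eq (can_inj sK)) eq_sym ordS_neq // ltnW.
move: (last_h _ d1) (last_h _ d2) ne => {last_h d1 d2}.
rewrite -val_eqE; move: (s i) (s (ordS i)) => a b ha hb ne.
have H1 (x y : 'I_n) : x = n.-1 :> nat -> y = 0 :> nat -> y = ordS x.
  by move=> E1 E2; apply: ord_inj; rewrite val_ordS E1 E2 prednK ?eqxx //; lia.
have H2 (x y : 'I_n) : x = n.-1 :> nat -> y = 0 :> nat -> x = ord_pred y.
  by move=> E1 E2; apply: ord_inj; rewrite val_ord_pred E1 E2.
case: ha hb => E1 [] E2; [by case/eqP: ne; exact: etrans E1 (esym E2) | left | right | ].
- exact: H1.
- exact: H2.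
- by case/eqP: ne; exact: etrans E1 (esym E2).
Qed.

Lemma letter_ext (x y : option bool) :
  (x == Some true) = (y == Some true) -> (x == Some false) = (y == Some false) -> x = y.
Proof. by case: x => [[]|]; case: y => [[]|]. Qed.

Lemma rigidity :
  (forall i, s (ordS i) = ordS (s i)) /\ (forall i, h (s i) = g i) \/
  (forall i, s (ordS i) = ord_pred (s i)) /\
  (forall i, h (s (ordS i)) = opp_letter (g i)).
Proof.
case: (cyclic_map n2 (can_inj sK) s_cyclic) => sS; [left | right]; split=> // i.
  by apply: letter_ext; rewrite -!edge_ordS -sS edge_s.
have E : ordS (s (ordS i)) = s i by rewrite sS ord_predK.
apply: letter_ext.
  have -> : (opp_letter (g i) == Some true) = (g i == Some false) by case: (g i) => [[]|].
  by rewrite -!edge_ordS E edge_s.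
have -> : (opp_letter (g i) == Some false) = (g i == Some true) by case: (g i) => [[]|].
by rewrite -!edge_ordS E edge_s.
Qed.

End Rigidity.

Lemma rot_of_cyclic_map n (s : 'I_n -> 'I_n) (w u : seq (option bool)) :
  size w = n -> size u = n -> (forall i, s (ordS i) = ordS (s i)) ->
  (forall i : 'I_n, nth None u (s i) = nth None w i) -> exists k, w = rot k u.
Proof.
move=> sw su sS us; case: n => [|n] in s sw su sS us *.
  by exists 0; rewrite (size0nil sw) (size0nil su).
exists (s ord0); apply: (@eq_from_nth _ None) => [|i]; first by rewrite size_rot sw.
rewrite sw => lti; rewrite nth_rot ?su //; last exact: ltnW.
have E : s (inord i) = (i + s ord0) %% n.+1 :> nat.
  elim: i lti => [|i IH] lti.
    by rewrite add0n modn_small //; congr (nat_of_ord (s _)); apply: ord_inj; rewrite inordK.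
  have -> : inord i.+1 = ordS (inord i : 'I_n.+1).
    apply: ord_inj; rewrite val_ordS !inordK //; last exact: ltnW.
    by case: eqP => // E; rewrite -E ltnn in lti.
  rewrite sS /= IH; last exact: ltnW.
  by rewrite -addn1 modnDml addn1 addSn.
by rewrite -E us inordK.
Qed.

Lemma iso_necklace_size w u : iso (necklace w) (necklace u) -> size w = size u.
Proof. by move/iso_card; rewrite !card_ord. Qed.

Lemma iso_dihedral w u : well_formed w -> well_formed u ->
  iso (necklace w) (necklace u) -> w \in dihedral u.
Proof.
move=> ww wu iswu; have sz := iso_necklace_size iswu.
have u0 : 0 < size u by case/and3P: wu.
(* Rigidity needs more than two vertices, so the words of length at most 2 are compared directly. *)
have [n2|n2] := ltnP 2 (size u); last first.
  move: ww wu sz u0 n2; rewrite /well_formed.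
  case: w u {iswu} => [|x [|y [|? ?]]] [|x' [|y' [|? ?]]] //=.
    by case: x => [?|] //; case: x' => [?|].
  by case: x => [[]|] //; case: y => [?|] //; case: x' => [[]|] //; case: y' => [?|].
have := iswu; rewrite (iso_congr (necklace_funE sz) (iso_refl _)).
case/isoP=> s [[t sK tK] edge_s].
have := rigidity n2 (fun i => well_formed_nth wu) sK tK edge_s.
case=> [] [sS us]; apply/dihedralP => //.
  by have [k ->] := rot_of_cyclic_map sz erefl sS us; exists k; left.
have szb : size (backward w) = size u by rewrite size_backward.
(* Precomposing with the reflection of [iso_backward] turns s into a rotation carrying [backward w]
   to u. *)
pose s' i := s (ordS (rev_ord i)).
have [i|i|k E] := @rot_of_cyclic_map _ s' _ u szb erefl.
- by rewrite /s' ordS_rev sS ord_predK.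
- rewrite /s' us /backward nth_rev size_map sz //.
  rewrite (nth_map None); last by rewrite sz; have := ltn_ord i; lia.
  by [].
exists (size u - k); right.
by rewrite -[w]backwardK E /backward map_rot rev_rot /rotr size_rev size_map.
Qed.

(** * Switching words and counting switchings into a given class *)

Lemma well_formedP w :
  reflect [/\ 0 < size w, forall i, i < (size w).-1 -> nth None w i != None
            & (nth None w (size w).-1 == None) || (2 < size w)]
          (well_formed w).
Proof.
apply: (iffP idP) => [ww|[w0 all_some lastw]].
  split; [by case/and3P: ww | by move=> i; apply: well_formed_nth |].
  by rewrite nth_last; case/and3P: ww.
apply/and3P; split=> //; last by rewrite -nth_last.
apply/(all_nthP None) => i; rewrite size_takel ?leq_pred // => lti.
by rewrite nth_take //; have := all_some _ lti; case: (nth _ _ _).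
Qed.

(* b is the indicator function of the set of switched vertices. *)
Definition switch_word (b : nat -> bool) (w : seq (option bool)) :=
  mkseq (fun i => if b i (+) b (i.+1 %% size w) then opp_letter (nth None w i)
                  else nth None w i) (size w).

Lemma size_switch_word b w : size (switch_word b w) = size w.
Proof. exact: size_mkseq. Qed.

Lemma eq_switch_word b c w : (forall i, i < size w -> b i = c i) ->
  switch_word b w = switch_word c w.
Proof.
move=> bc; apply: (@eq_from_nth _ None); rewrite !size_switch_word // => i lti.
by rewrite !nth_mkseq // !bc // ltn_mod; case: (size w) lti.
Qed.

Lemma opp_letter_eqN x : (opp_letter x == None) = (x == None).
Proof. by case: x. Qed.

Lemma well_formed_switch b w : well_formed w -> well_formed (switch_word b w).
Proof.
case/well_formedP=> w0 all_some lastw; apply/well_formedP; rewrite size_switch_word.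
split=> // [i lti|].
  rewrite nth_mkseq; last by lia.
  by case: ifP => _; rewrite ?opp_letter_eqN; apply: all_some.
rewrite nth_mkseq ?ltn_predL //.
by case: ifP => _; rewrite ?opp_letter_eqN.
Qed.

Definition bits n (S : {set 'I_n}) (i : nat) : bool := oapp (mem S) false (insub i).

Lemma bitsE n (S : {set 'I_n}) (i : 'I_n) : bits S i = (i \in S).
Proof. by rewrite /bits valK. Qed.

Lemma iso_switch_word w (S : {set necklace w}) :
  iso (switch_set S) (necklace (switch_word (bits S) w)).
Proof.
have E := necklace_funE (size_switch_word (bits S) w).
rewrite iso_sym; apply: (iso_trans E); rewrite iso_sym.
apply: iso_edges => x y /=.
have nthE (i : 'I_(size w)) : nth None (switch_word (bits S) w) i =
    if (i \in S) (+) (ordS i \in S) then opp_letter (nth None w i) else nth None w i.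
  by rewrite nth_mkseq // bitsE -[_.+1 %% _]/(nat_of_ord (ordS i)) bitsE.
rewrite !nthE; move: (nth None w x) (nth None w y) => a b.
case: (eqVneq y (ordS x)) => [<-|_]; case: (eqVneq x (ordS y)) => [<-|_];
  by case: (x \in S); case: (y \in S); case: a => [[]|]; case: b => [[]|].
Qed.

Lemma iso_switch_vertex w (v : necklace w) :
  iso (switch v) (necklace (switch_word (pred1 (v : nat)) w)).
Proof.
apply: iso_trans (switch_set1 v) _; apply: iso_trans (iso_switch_word _) _.
rewrite (@eq_switch_word _ (pred1 (v : nat))) ?iso_refl // => i lti.
by rewrite -[i]/(nat_of_ord (Ordinal lti)) bitsE inE.
Qed.

Lemma well_formed_dihedral_self w : well_formed w -> w \in dihedral w.
Proof. by case/and3P=> w0 _ _; apply/dihedralP => //; exists 0; left; rewrite rot0. Qed.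

(** Counted with repetitions, hence an upper bound for the number of well-formed words of the class
    of w. *)
Definition orbit_size (w : seq (option bool)) :=
  size [seq u <- dihedral w | well_formed u].

Lemma opp_letter_neq x : x != None -> opp_letter x != x.
Proof. by case: x => [[]|]. Qed.

(** A letter that is not a gap is flipped exactly when one of its two ends is in S. So the switched
    word, together with the membership of vertex 0, determines S: the factor 2 accounts for S and
    its complement. *)
Lemma card_switch_set_iso w a : well_formed w -> well_formed a ->
  #|[set S : {set necklace w} | iso (switch_set S) (necklace a)]| <= 2 * orbit_size a.
Proof.
move=> ww wa; set N := [set _ | _].
have w0 : 0 < size w by case/and3P: ww.
pose code (S : {set 'I_(size w)}) := (bits S 0, switch_word (bits S) w).
have code_inj : injective code.
  move=> S U [E0 Ew]; apply/setP=> i.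
  suff H k : k < size w -> bits S k = bits U k by rewrite -!bitsE H.
  elim: k => // k IH ltk; have := congr1 (fun v => nth None v k) Ew.
  rewrite !nth_mkseq; [|by lia..].
  rewrite IH; last by lia.
  rewrite (modn_small ltk).
  have /opp_letter_neq : nth None w k != None by apply: well_formed_nth => //; lia.
  case: (bits U k) (bits S k.+1) (bits U k.+1) => [] [] [] //= ne E;
    by [rewrite E eqxx in ne | rewrite -E eqxx in ne].
rewrite cardE -(size_map code).
have -> : 2 * orbit_size a = size (allpairs pair [:: true; false]
             [seq u <- dihedral a | well_formed u]) by rewrite size_allpairs.
apply: uniq_leq_size => [|c /mapP[S]]; first by rewrite map_inj_uniq ?enum_uniq.
rewrite mem_enum inE => isoS ->; apply/allpairsP; exists (code S); split=> //.
  by case: (code S).1.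
have wS := well_formed_switch (bits S) ww.
rewrite mem_filter wS; apply: iso_dihedral => //.
by apply: iso_trans isoS; rewrite iso_sym; apply: iso_switch_word.
Qed.

Lemma necklace_connected w (p : pred (necklace w)) : well_formed w ->
  (forall x y, adjacent x y -> p x -> p y) -> forall x y, p x -> p y.
Proof.
move=> ww pA; have w0 : 0 < size w by case/and3P: ww.
have adj_next (i j : necklace w) : j = i.+1 :> nat -> adjacent i j.
  move=> E; have ltj := ltn_ord j.
  have Ej : j = ordS i.
    by apply: (@ord_inj (size w)); rewrite val_ordS; case: eqP => // E'; move: ltj; rewrite E E' ltnn.
  rewrite Ej /adjacent /= eqxx /=.
  have : nth None w i != None by apply: well_formed_nth => //; move: ltj; rewrite E; lia.
  by case: (nth _ _ _) => [[]|]; rewrite ?orbT.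
have adj_sym (x y : necklace w) : adjacent x y = adjacent y x by rewrite /adjacent orbC.
have p0 (i : necklace w) : p i = p (Ordinal w0).
  case: i; elim=> [|k IH] ltk; first by congr p; apply: ord_inj.
  rewrite -(IH (ltnW ltk)); apply/idP/idP; apply: pA; last exact: adj_next.
  by rewrite adj_sym; apply: adj_next.
by move=> x y; rewrite !p0.
Qed.

(** * Canonical words *)

Definition letter_rank (x : option bool) : nat :=
  match x with Some true => 0 | Some false => 1 | None => 2 end.

Fixpoint lex_le (u w : seq (option bool)) : bool :=
  match u, w with
  | [::], _ => true
  | _ :: _, [::] => false
  | x :: u', y :: w' =>
      if letter_rank x < letter_rank y then true
      else if letter_rank y < letter_rank x then false else lex_le u' w'
  end.

Lemma lex_le_total : total lex_le.
Proof.
elim=> [|x u IH] [|y w] //=.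
by case: (ltngtP (letter_rank x) (letter_rank y)).
Qed.

Lemma letter_rank_inj : injective letter_rank.
Proof. by case=> [[]|] [[]|]. Qed.

Lemma lex_le_anti : antisymmetric lex_le.
Proof.
elim=> [|x u IH] [|y w] //=.
by case: (ltngtP (letter_rank x) (letter_rank y)) => // /letter_rank_inj -> /IH ->.
Qed.

Lemma lex_le_trans : transitive lex_le.
Proof.
elim=> [|y v IH] [|x u] [|z w] //=.
case: (ltngtP (letter_rank x) (letter_rank y)) => // [lt|/letter_rank_inj->].
  by case: (ltngtP (letter_rank y) (letter_rank z)) => // [lt'|<-]; rewrite ?lt // (ltn_trans lt lt').
by case: (ltngtP (letter_rank y) (letter_rank z)) => // _; apply: IH.
Qed.

Definition lex_min (u w : seq (option bool)) := if lex_le u w then u else w.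

Definition canon (w : seq (option bool)) :=
  foldr lex_min w [seq u <- dihedral w | well_formed u].

Lemma foldr_lex_min w s : (foldr lex_min w s \in w :: s) /\
  (forall u, u \in w :: s -> lex_le (foldr lex_min w s) u).
Proof.
elim: s => [|x s [IHm IHle]] /=.
  split=> [|u]; first exact: mem_head.
  by rewrite inE => /eqP->; case/orP: (lex_le_total w w).
split=> [|u]; rewrite /lex_min.
  case: ifP => _; first by rewrite !inE eqxx orbT.
  by move: IHm; rewrite !inE => /orP[->|->] //; rewrite !orbT.
have H : lex_le (if lex_le x (foldr lex_min w s) then x else foldr lex_min w s) x &&
         lex_le (if lex_le x (foldr lex_min w s) then x else foldr lex_min w s) (foldr lex_min w s).
  case: ifP => H; first by rewrite H andbT; case/orP: (lex_le_total x x).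
  have := lex_le_total x (foldr lex_min w s); rewrite H /= => ->.
  by case/orP: (lex_le_total (foldr lex_min w s) (foldr lex_min w s)).
case/andP: H => H1 H2; rewrite !inE orbCA => /orP[/eqP->//|us].
by apply: lex_le_trans H2 (IHle _ _); rewrite inE.
Qed.

Lemma canon_mem w : well_formed w -> canon w \in [seq u <- dihedral w | well_formed u].
Proof.
move=> ww; have [] := foldr_lex_min w [seq u <- dihedral w | well_formed u].
rewrite inE => /orP[/eqP E|//] _.
by rewrite /canon E mem_filter ww well_formed_dihedral_self.
Qed.

Lemma well_formed_canon w : well_formed w -> well_formed (canon w).
Proof. by move/canon_mem; rewrite mem_filter => /andP[]. Qed.

Lemma iso_canon w : well_formed w -> iso (necklace w) (necklace (canon w)).
Proof. by move/canon_mem; rewrite mem_filter => /andP[_ /dihedral_iso]. Qed.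

(** By [iso_dihedral], isomorphic necklaces have the same set of well-formed words and therefore the
    same minimum. *)
Lemma canon_eq w u : well_formed w -> well_formed u ->
  (canon w == canon u) = iso (necklace w) (necklace u).
Proof.
move=> ww wu; apply/eqP/idP => [E|iswu].
  by apply: iso_trans (iso_canon ww) _; rewrite E iso_sym iso_canon.
have le a b : well_formed a -> well_formed b -> iso (necklace a) (necklace b) ->
    lex_le (canon a) (canon b).
  move=> wa wb ab; apply: (foldr_lex_min _ _).2; rewrite inE mem_filter.
  rewrite well_formed_canon //= (iso_dihedral _ wa) ?orbT ?well_formed_canon //.
  by rewrite iso_sym; apply: iso_trans ab (iso_canon wb).
by apply: lex_le_anti; rewrite !le // iso_sym.
Qed.

Definition canonical w := well_formed w && (canon w == w).

Lemma canonical_canon w : well_formed w -> canonical (canon w).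
Proof.
move=> ww; rewrite /canonical well_formed_canon // canon_eq ?well_formed_canon //.
by rewrite iso_sym iso_canon.
Qed.

Lemma canonical_iso w u : canonical w -> canonical u ->
  iso (necklace w) (necklace u) = (w == u).
Proof.
by case/andP=> ww /eqP cw /andP[wu /eqP cu]; rewrite -canon_eq // cw cu.
Qed.

(** * Connected components *)

Lemma inj_surj_bij (T U : finType) (f : T -> U) :
  injective f -> (forall y, exists x, f x = y) -> bijective f.
Proof.
move=> injf surjf; apply: inj_card_bij => //.
rewrite -(card_codom injf); apply: subset_leq_card; apply/subsetP=> y _.
by have [x <-] := surjf y; apply: codom_f.
Qed.

Definition induced (G : digraph) (p : pred G) : digraph :=
  @Digraph {x | p x} (fun a b => edge G (val a) (val b)).

Definition component (G : digraph) (x : G) : digraph :=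
  induced (connect (@adjacent G) x).

Lemma connect_homo (T U : finType) (e : rel T) (e' : rel U) (f : T -> U) x y :
  (forall x y, e x y -> e' (f x) (f y)) -> connect e x y -> connect e' (f x) (f y).
Proof.
move=> ee' /connectP[p]; elim: p x => [|z p IH] x /=; first by move=> _ ->.
by case/andP=> /ee' xz pz Ey; apply: connect_trans (connect1 xz) (IH _ pz Ey).
Qed.

(** Closure of the image under adjacency is what isomorphisms and the two injections into a disjoint
    union have in common. *)
Lemma iso_component_embed (G H : digraph) (f : G -> H) (x : G) :
  injective f -> (forall x y, edge H (f x) (f y) = edge G x y) ->
  (forall x y, adjacent (f x) y -> exists z, f z = y) ->
  iso (component x) (component (f x)).
Proof.
move=> injf edgef closedf.
have adjf u v : adjacent (f u) (f v) = adjacent u v by rewrite /adjacent !edgef.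
have fwd z : connect (@adjacent G) x z -> connect (@adjacent H) (f x) (f z).
  by apply: connect_homo => u v; rewrite adjf.
have bwd y : connect (@adjacent H) (f x) y ->
    exists2 z, connect (@adjacent G) x z & f z = y.
  case/connectP=> p; elim: p x {fwd} => [|y' p IH] x /=.
    by move=> _ ->; exists x; first exact: connect0.
  case/andP=> xy' pp Ey; have [z' Ez'] := closedf _ _ xy'; subst y'.
  have [z xz Ez] := IH _ pp Ey; exists z => //.
  by apply: connect_trans xz; apply: connect1; rewrite -adjf.
pose h (a : component x) : component (f x) := Sub (f (val a)) (fwd _ (valP a)).
apply: (@isoI (component x) (component (f x)) h) => [|a b]; last by rewrite /= edgef.
apply: inj_surj_bij => [a b /(congr1 val) /= /injf /val_inj // | [y py]].
have [z xz Ez] := bwd _ py; exists (Sub z xz); exact: val_inj.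
Qed.

Lemma iso_component (G H : digraph) (f : G -> H) (x : G) :
  bijective f -> (forall x y, edge H (f x) (f y) = edge G x y) ->
  iso (component x) (component (f x)).
Proof.
move=> bijf edgef; apply: iso_component_embed => //; first exact: bij_inj.
by move=> u y _; case: bijf => g _ gK; exists (g y).
Qed.

Lemma iso_component_inl (G H : digraph) (x : G) :
  iso (component x) (@component (union G H) (inl x)).
Proof.
apply: (@iso_component_embed G (union G H) inl) => // [a b [] //|a [z|z]].
  by exists z.
by rewrite /adjacent.
Qed.

Lemma iso_component_inr (G H : digraph) (x : H) :
  iso (component x) (@component (union G H) (inr x)).
Proof.
apply: (@iso_component_embed H (union G H) inr) => // [a b [] //|a [z|z]].
  by rewrite /adjacent.
by exists z.
Qed.

Lemma iso_component_necklace w (x : necklace w) : well_formed w ->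
  iso (component x) (necklace w).
Proof.
move=> ww; apply: (@isoI (component x) (necklace w) val) => //.
apply: inj_surj_bij => [|y]; first exact: val_inj.
suff xy : connect (@adjacent (necklace w)) x y by exists (Sub y xy).
apply: (@necklace_connected w (connect (@adjacent _) x) ww _ x y) => // u v uv xu.
exact: connect_trans xu (connect1 uv).
Qed.

(** The sum runs over vertices, so each component isomorphic to K counts as many times as it has
    vertices. The factor cancels in [realize_inj], and no set of components has to be built. *)
Definition component_count (G K : digraph) : nat :=
  \sum_(x : G) iso (component x) K.

Lemma component_count_iso (G H K : digraph) :
  iso G H -> component_count G K = component_count H K.
Proof.
case/isoP=> f [bijf edgef]; rewrite /component_count [RHS](reindex f); last exact: onW_bij.
by apply: eq_bigr => x _; rewrite (iso_congr (iso_component x bijf edgef) (iso_refl K)).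
Qed.

Lemma component_count_union (G H K : digraph) :
  component_count (union G H) K = component_count G K + component_count H K.
Proof.
rewrite /component_count big_sumType /=; congr (_ + _); apply: eq_bigr => x _.
  by rewrite (iso_congr (iso_component_inl H x) (iso_refl K)).
by rewrite (iso_congr (iso_component_inr G x) (iso_refl K)).
Qed.

Lemma component_count_necklace w K : well_formed w ->
  component_count (necklace w) K = size w * iso (necklace w) K.
Proof.
move=> ww; rewrite /component_count.
under eq_bigr => x _ do rewrite (iso_congr (iso_component_necklace x ww) (iso_refl K)).
by rewrite sum_nat_const card_ord.
Qed.

Definition realize (L : seq (seq (option bool))) : digraph :=
  foldr (fun w G => union (necklace w) G) (necklace [::]) L.

Lemma component_count_realize L u : all canonical L -> canonical u ->
  component_count (realize L) (necklace u) = size u * count_mem u L.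
Proof.
move=> cL cu; elim: L cL => [_|w L IH /= /andP[cw cL]].
  by rewrite /component_count big_ord0 muln0.
rewrite component_count_union IH // component_count_necklace; last by case/andP: cw.
by rewrite canonical_iso // mulnDr; case: eqP => [->|_]; rewrite ?muln0.
Qed.

Lemma realize_inj L L' : all canonical L -> all canonical L' ->
  iso (realize L) (realize L') -> perm_eq L L'.
Proof.
move=> cL cL' isoLL'; apply/allP=> u uLL'.
have cu : canonical u.
  by move: uLL'; rewrite mem_cat => /orP[]; [move/(allP cL) | move/(allP cL')].
have := component_count_iso (necklace u) isoLL'; rewrite !component_count_realize //.
by move/eqP; rewrite eqn_pmul2l //; case/andP: cu => /and3P[].
Qed.

Lemma iso_union (G G' H H' : digraph) : iso G G' -> iso H H' ->
  iso (union G H) (union G' H').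
Proof.
case/isoP=> f [[f' fK f'K] edgef] /isoP[g [[g' gK g'K] edgeg]].
pose h (x : union G H) : union G' H' :=
  match x with inl a => inl (f a) | inr b => inr (g b) end.
apply: (@isoI (union G H) (union G' H') h); last by case=> a [] b /=.
exists (fun x => match x with inl a => inl (f' a) | inr b => inr (g' b) end).
  by case=> a /=; rewrite ?fK ?gK.
by case=> a /=; rewrite ?f'K ?g'K.
Qed.

Lemma iso_unionA (G H K : digraph) :
  iso (union (union G H) K) (union G (union H K)).
Proof.
pose h (x : union (union G H) K) : union G (union H K) :=
  match x with inl (inl a) => inl a | inl (inr b) => inr (inl b) | inr c => inr (inr c) end.
apply: (@isoI _ _ h); last by case=> [[]|] a [[]|] b.
by exists (fun x => match x with inl a => inl (inl a) | inr (inl b) => inl (inr b)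
                              | inr (inr c) => inr c end); [case=> [[]|] | case=> [|[]]].
Qed.

Lemma iso_unionC (G H : digraph) : iso (union G H) (union H G).
Proof.
pose h (x : union G H) : union H G := match x with inl a => inr a | inr b => inl b end.
apply: (@isoI _ _ h); last by case=> a [] b.
by exists (fun x => match x with inl a => inr a | inr b => inl b end); case.
Qed.

Lemma iso_union0 (G : digraph) : iso (union (necklace [::]) G) G.
Proof.
rewrite iso_sym; apply: (@isoI G (union (necklace [::]) G) inr) => //.
by apply: inj_surj_bij => [x y [] //|[[]|x]] //; exists x.
Qed.

Lemma realize_rem w L : w \in L -> iso (realize L) (realize (w :: rem w L)).
Proof.
elim: L => //= u L IH; rewrite inE eq_sym; case: eqP => [->|_] /= wL; first exact: iso_refl.
apply: iso_trans (iso_union (iso_refl _) (IH wL)) _ => /=.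
rewrite iso_sym; apply: iso_trans (_ : iso _ (union (union (necklace w) (necklace u)) _)) _.
  by rewrite iso_sym; apply: iso_unionA.
by apply: iso_trans (iso_union (iso_unionC _ _) (iso_refl _)) (iso_unionA _ _ _).
Qed.

Lemma realize_perm L L' : perm_eq L L' -> iso (realize L) (realize L').
Proof.
elim: L L' => [|w L IH] L' pLL'.
  by move: pLL'; rewrite perm_sym => /perm_nilP ->; apply: iso_refl.
have wL' : w \in L' by rewrite -(perm_mem pLL') mem_head.
rewrite iso_sym; apply: iso_trans (realize_rem wL') _; rewrite iso_sym.
apply: iso_union (iso_refl _) (IH _ _).
by rewrite -(perm_cons w) (perm_trans pLL') // perm_to_rem.
Qed.

Lemma realize_iso L L' : all canonical L -> all canonical L' ->
  iso (realize L) (realize L') = perm_eq L L'.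
Proof. by move=> cL cL'; apply/idP/idP; [apply: realize_inj | apply: realize_perm]. Qed.

(** * Every admissible digraph is a union of necklaces *)

Lemma admissibleP (G : digraph) :
  admissible G <-> oriented G /\ forall v : G, #|[set w : G | adjacent v w]| <= 2.
Proof.
split=> -[orG degG]; split=> //.
  by move=> v; move/bigmax_leqP: degG => /(_ v isT).
by apply/bigmax_leqP => v _; apply: degG.
Qed.

Lemma admissible_embed (G H : digraph) (f : G -> H) : injective f ->
  (forall x y, edge H (f x) (f y) = edge G x y) -> admissible H -> admissible G.
Proof.
move=> injf edgef /admissibleP[orH degH]; apply/admissibleP; split=> [x y|v].
  by rewrite -!edgef => /orH[]; rewrite (inj_eq injf).
apply: leq_trans (degH (f v)); rewrite -(card_imset _ injf).
apply: subset_leq_card; apply/subsetP => _ /imsetP[w + ->].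
by rewrite !inE /adjacent !edgef.
Qed.

Lemma admissible_iso (G H : digraph) : iso G H -> admissible G -> admissible H.
Proof.
rewrite iso_sym => /isoP[f [bijf edgef]].
exact: admissible_embed (bij_inj bijf) edgef.
Qed.

Lemma admissible_induced (G : digraph) (p : pred G) :
  admissible G -> admissible (induced p).
Proof. by apply: (@admissible_embed (induced p) G val) => //; apply: val_inj. Qed.

Lemma admissible_union (G H : digraph) :
  admissible G -> admissible H -> admissible (union G H).
Proof.
move=> /admissibleP[orG degG] /admissibleP[orH degH]; apply/admissibleP.
split=> [[x|x] [y|y] //= | [v|v]].
- by move=> /orG[].
- by move=> /orH[].
- apply: leq_trans (degG v); rewrite -(card_imset _ (@inl_inj G H)).
  apply: subset_leq_card; apply/subsetP => -[w|w]; rewrite !inE // => vw.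
  by apply: imset_f; rewrite inE.
apply: leq_trans (degH v); rewrite -(card_imset _ (@inr_inj G H)).
apply: subset_leq_card; apply/subsetP => -[w|w]; rewrite !inE // => vw.
by apply: imset_f; rewrite inE.
Qed.

Lemma admissible_necklace w : well_formed w -> admissible (necklace w).
Proof.
case/well_formedP=> w0 _ lastw; apply/admissibleP; split=> [x y|v]; last first.
  apply: leq_trans (_ : #|[set ordS v; ord_pred v]| <= 2).
    apply: subset_leq_card; apply/subsetP=> y; rewrite !inE /adjacent /=.
    case: (y =P ordS v) => //= _; case: (v =P ordS y) => [->|] //=.
    by rewrite ordSK eqxx.
  by rewrite cards2; case: eqP.
have [n2|n2] := ltnP 2 (size w).
  have H (a b : necklace w) : b == ordS a -> (a == ordS b) = false.
    by move/eqP->; apply/negbTE; rewrite eq_sym ordSS_neq.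
  have H' (a : necklace w) : (a == ordS a) = false.
    by apply/negbTE; rewrite eq_sym ordS_neq // ltnW.
  move=> /=; case: (eqVneq x y) => [->|_]; first by rewrite H'.
  case yx: (y == ordS x); case xy: (x == ordS y); rewrite ?(H _ _ yx) // in xy *;
    by case: (nth _ _ x) => [[]|]; case: (nth _ _ y) => [[]|].
move: lastw w0; rewrite (leq_gtF n2) orbF.
case: w n2 x y => [|a [|b [|? ?]]] // _ x y /eqP /= -> _.
  by case: x y => [[|x] ltx] [[|y] lty].
by move: a x y => [[]|] [[|[|x]] ltx] [[|[|y]] lty].
Qed.

Lemma admissible_realize L : all well_formed L -> admissible (realize L).
Proof.
elim: L => [_|w L IH /= /andP[ww wL]].
  by apply/admissibleP; split=> [[]|[]].
exact: admissible_union (admissible_necklace ww) (IH wL).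
Qed.

Section LongestPath.
Variables (G : digraph) (x0 : G) (s : seq G).
Hypotheses (orG : oriented G) (degG : forall v : G, #|[set w : G | adjacent v w]| <= 2).
Hypotheses (us : uniq s) (paths : sorted (@adjacent G) s) (s0 : 0 < size s).
Hypothesis maxs : forall s', uniq s' -> sorted (@adjacent G) s' -> size s' <= size s.

Local Notation v := (nth x0 s).

Lemma adjacentC : symmetric (@adjacent G).
Proof. by move=> x y; rewrite /adjacent orbC. Qed.

Lemma adjacent_irr x : @adjacent G x x = false.
Proof. by apply/negP; rewrite /adjacent orbb => /orG[]; rewrite eqxx. Qed.

Lemma adjacent_next i : i.+1 < size s -> adjacent (v i) (v i.+1).
Proof. by move=> lti; have /(sortedP x0) := paths; apply. Qed.

Lemma adjacent_pair (x a b y : G) : a != b -> adjacent x a -> adjacent x b ->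
  adjacent x y -> y = a \/ y = b.
Proof.
move=> ab xa xb xy; have [->|ya] := eqVneq y a; first by left.
have [->|yb] := eqVneq y b; first by right.
have : #|[set a; b; y]| <= 2.
  apply: leq_trans (degG x); apply: subset_leq_card; apply/subsetP => z.
  by rewrite !inE => /orP[/orP[]|] /eqP->.
by rewrite setUC cardsU1 !inE negb_or ya yb cards2 ab.
Qed.

Lemma adjacent_inner i y : 0 < i -> i.+1 < size s -> adjacent (v i) y ->
  y = v i.-1 \/ y = v i.+1.
Proof.
move=> i0 lti; have lti' : i.-1 < size s by lia.
apply: adjacent_pair.
- by rewrite nth_uniq //; lia.
- by rewrite adjacentC -{2}(prednK i0); apply: adjacent_next; lia.
- exact: adjacent_next.
Qed.

(** Otherwise y would prolong the longest path at that end. *)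
Lemma adjacent_ends i y : i = 0 \/ i = (size s).-1 -> adjacent (v i) y -> y \in s.
Proof.
move=> Ei; apply: contraTT => ys; apply/negP=> iy.
case: Ei => Ei; move: iy; rewrite {}Ei => iy.
  have := @maxs (y :: s); rewrite /= ltnn ys us => H; suff : false by []; apply: H => //.
  by move: paths iy; case: (s) s0 => //= a p _ ->; rewrite adjacentC => ->.
have := @maxs (rcons s y); rewrite size_rcons ltnn rcons_uniq ys us => H.
suff : false by []; apply: H => //; move: paths iy; rewrite nth_last.
by case: (s) s0 => //= a p _; rewrite rcons_path => -> ->.
Qed.

(** An inner vertex already has its two neighbours on the path, and an end has none outside it by
    maximality. So a chord can only join the two ends, and the path spans a component that is a path
    or a cycle. *)
Lemma adjacent_cyclic i y : i < size s -> adjacent (v i) y ->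
  exists2 j, j < size s & y = v j /\ (j = i.+1 %% size s \/ i = j.+1 %% size s).
Proof.
move=> lti iy.
have small j : j.+1 < size s -> j.+1 %% size s = j.+1 by move=> lt; rewrite modn_small.
have [/andP[i0 i1]|ends] := boolP ((0 < i) && (i.+1 < size s)).
  case: (adjacent_inner i0 i1 iy) => ->.
    exists i.-1; first by lia.
    by split=> //; right; rewrite prednK // modn_small.
  by exists i.+1 => //; split=> //; left; rewrite small.
have Ei : i = 0 \/ i = (size s).-1 by lia.
have ys := adjacent_ends Ei iy; set j := index y s.
have ltj : j < size s by rewrite index_mem.
have Ey : y = v j by rewrite nth_index.
exists j => //; split=> //.
have ij : i <> j by move=> E; move: iy; rewrite Ey E adjacent_irr.
have [/andP[j0 j1]|endsj] := boolP ((0 < j) && (j.+1 < size s)); last first.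
  have Ej : j = 0 \/ j = (size s).-1 by lia.
  have mz : (size s).-1.+1 %% size s = 0 by rewrite prednK // modnn.
  by case: Ei Ej => Ei [] Ej; [lia | right | left | lia]; rewrite Ei Ej mz.
have : adjacent (v j) (v i) by rewrite adjacentC -Ey.
have ltj' : j.-1 < size s by lia.
case/(adjacent_inner j0 j1) => /eqP; rewrite nth_uniq // => /eqP E.
  by left; rewrite small; lia.
by right; rewrite small.
Qed.

Definition edge_letter (x y : G) : option bool :=
  if edge G x y then Some true else if edge G y x then Some false else None.

(** On at most two vertices the closing letter is forced to be a gap: for two vertices it would
    record their single edge a second time. *)
Definition path_word := mkseq (fun i => if (i.+1 < size s) || (2 < size s)
  then edge_letter (v i) (v (i.+1 %% size s)) else None) (size s).

Lemma well_formed_path_word : well_formed path_word.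
Proof.
apply/well_formedP; rewrite size_mkseq; split=> // [i lti|].
  have lti' : i.+1 < size s by lia.
  rewrite nth_mkseq ?(ltnW lti') //.
  rewrite lti' modn_small // /edge_letter.
  by have := adjacent_next lti'; rewrite /adjacent; do 2?case: (edge _ _ _).
rewrite nth_mkseq ?ltn_predL // prednK // ltnn.
by case: ltnP => //; rewrite orbT.
Qed.

Lemma iso_path_word :
  iso (union (necklace path_word) (induced (fun y => y \notin s))) G.
Proof.
have szw : size path_word = size s by rewrite size_mkseq.
apply: iso_trans (iso_union (necklace_funE szw) (iso_refl _)) _.
set N := necklace_fun _; set I := induced _.
pose h (x : union N I) : G := match x with inl i => v (i : 'I_(size s)) | inr y => val y end.
have edge_h (i j : 'I_(size s)) : edge G (v i) (v j) = edge N i j.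
  rewrite /= !nth_mkseq //.
  have E (a b : 'I_(size s)) c : (b == ordS a) &&
      ((if (a.+1 < size s) || (2 < size s) then edge_letter (v a) (v (a.+1 %% size s)) else None) == Some c)
      = (b == ordS a) && ((a.+1 < size s) || (2 < size s)) && (edge_letter (v a) (v b) == Some c).
    rewrite -andbA; case: eqP => // ->.
    by case: ((a.+1 < size s) || _).
  rewrite !E /edge_letter.
  have [eij|] := boolP (edge G (v i) (v j)); last first.
    by move=> _; case: (edge G (v j) (v i)); rewrite /= ?andbF.
  have [nij nji] := orG eij; rewrite (negPf nji) /= !andbT; symmetry.
  have adj : adjacent (v i) (v j) by rewrite /adjacent eij.
  have [k ltk [/eqP]] := adjacent_cyclic (ltn_ord i) adj.
  rewrite nth_uniq // => /eqP <- {k ltk} cyc.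
  have ij : i <> j :> nat by move=> E'; rewrite E' eqxx in nij.
  have [lti ltj] := (ltn_ord i, ltn_ord j).
  case: cyc => E'.
    have -> : j = ordS i by apply: ord_inj.
    rewrite eqxx /=; case: (ltnP i.+1 _) => //= H.
    (* What remains is the wrap-around step on two vertices: the edge from the last vertex to vertex
       0 is recorded by letter 0, read backwards. *)
    case: (ltnP 2 _) => //= H2; rewrite orbF.
    have Ei : i.+1 = size s by lia.
    have j0 : j = 0 :> nat by rewrite E' Ei modnn.
    have j1 : j.+1 < size s by lia.
    have Ei1 : i = ordS j by apply: ord_inj; rewrite val_ordS; case: eqP; lia.
    have Ej1 : j = ordS i by apply: ord_inj.
    by rewrite -Ej1 -Ei1 eqxx -E' j1.
  have -> : i = ordS j by apply: ord_inj.
  rewrite eqxx /=; case: (ltnP j.+1 _) => //= H; first by rewrite orbT.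
  case: (ltnP 2 _) => //= H2; first by rewrite orbT.
  have Ej : j.+1 = size s by lia.
  have i0 : i = 0 :> nat by rewrite E' Ej modnn.
  have i1 : i.+1 < size s by lia.
  have Ej1 : j = ordS i by apply: ord_inj; rewrite val_ordS; case: eqP; lia.
  have Ei1 : i = ordS j by apply: ord_inj.
  by rewrite -Ei1 -Ej1 eqxx -E' i1.
have cross (i : 'I_(size s)) (y : I) : adjacent (v i) (val y) = false.
  apply/negP=> iy; have [j ltj [Ey _]] := adjacent_cyclic (ltn_ord i) iy.
  by case/negP: (valP y); rewrite Ey mem_nth.
apply: (@isoI _ _ h) => [|[i|x] [j|y] //=]; first last.
- by apply: contraFF (cross j x) => H; rewrite /adjacent H orbT.
- by apply: contraFF (cross i y) => H; rewrite /adjacent H.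
apply: inj_surj_bij => [[i|x] [j|y] /= E|y].
- by congr inl; apply: ord_inj; apply/eqP; rewrite -(nth_uniq x0 _ _ us) ?E ?ltn_ord.
- by have := valP y; rewrite /= -E mem_nth.
- by have := valP x; rewrite /= E mem_nth.
- by congr inr; apply: val_inj.
have [ys|ys] := boolP (y \in s); last by exists (inr (Sub y ys)).
have lty : index y s < size s by rewrite index_mem.
by exists (inl (Ordinal lty)); rewrite /= nth_index.
Qed.
End LongestPath.

Lemma longest_path (G : digraph) (x0 : G) : exists s : seq G,
  [/\ uniq s, sorted (@adjacent G) s, 0 < size s &
      forall s', uniq s' -> sorted (@adjacent G) s' -> size s' <= size s].
Proof.
pose p n := [exists t : n.-tuple G, uniq t && sorted (@adjacent G) t].
have p1 : exists n, p n by exists 1; apply/existsP; exists [tuple x0].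
have pmax n : p n -> n <= #|G|.
  by case/existsP=> t /andP[ut _]; rewrite -(size_tuple t) -(card_uniqP ut) max_card.
case: (ex_maxnP p1 pmax) => n /existsP[t /andP[ut st]] maxn.
exists t; rewrite size_tuple; split=> //.
  by apply: maxn; apply/existsP; exists [tuple x0].
by move=> s' us' ss'; apply: maxn; apply/existsP; exists (in_tuple s'); rewrite us'.
Qed.

(** Induction on the order: a longest path splits off a whole component. *)
Lemma admissible_realization (G : digraph) : admissible G ->
  exists2 L, all canonical L & iso G (realize L).
Proof.
move: {2}#|G|.+1 (ltnSn #|G|) => n; elim: n G => // n IH G ltG admG.
case: (pickP G) => [x0 _|noG]; last first.
  exists [::] => //; rewrite iso_sym.
  have noG' (x : G) : False by have := noG x.
  apply: (@isoI (necklace [::]) G (fun x => False_rect _ (let: Ordinal _ h := x in notF h))).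
    by apply: inj_surj_bij => [[]|x] //; case: (noG' x).
  by case.
have [s [us ss s0 maxs]] := longest_path x0.
have /admissibleP[orG degG] := admG.
have iG := iso_path_word x0 orG degG us ss s0 maxs.
have wf : well_formed (path_word x0 s) by apply: well_formed_path_word.
have [|L cL iL] := IH (induced (fun y => y \notin s)) _ (admissible_induced _ admG).
  have := iso_card iG; rewrite card_sum card_ord size_mkseq.
  by move: ltG s0; lia.
exists (canon (path_word x0 s) :: L); first by rewrite /= cL canonical_canon.
apply: iso_trans (_ : iso G _) _; first by rewrite iso_sym; apply: iG.
exact: iso_union (iso_canon wf) iL.
Qed.

(** * Decks of unions of necklaces *)

Definition switchings_word (w : seq (option bool)) : seq (seq (option bool)) :=
  [seq canon (switch_word (pred1 v) w) | v <- iota 0 (size w)].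

Lemma switch_inl (G H : digraph) (x : G) :
  iso (@switch (union G H) (inl x)) (union (switch x) H).
Proof. by apply: iso_edges => -[a|a] [b|b] /=; rewrite ?if_same. Qed.

Lemma switch_inr (G H : digraph) (x : H) :
  iso (@switch (union G H) (inr x)) (union G (switch x)).
Proof. by apply: iso_edges => -[a|a] [b|b] /=; rewrite ?if_same. Qed.

Section Decks.
Variables (T : eqType) (d : T -> seq T).

(** The Leibniz rule: a switching of a disjoint union acts on exactly one component. *)
Fixpoint switchings (L : seq T) : seq (seq T) :=
  if L is w :: L' then [seq u :: L' | u <- d w] ++ [seq w :: X | X <- switchings L']
  else [::].
End Decks.

Lemma big_switch_realize (V : Type) (idx : V) (op : Monoid.com_law idx)
    (psi : digraph -> V) (L : seq (seq (option bool))) :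
  iso_invariant psi -> all well_formed L ->
  \big[op/idx]_(v : realize L) psi (switch v) =
  \big[op/idx]_(X <- switchings switchings_word L) psi (realize X).
Proof.
elim: L psi => [|w L IH] psi inv; first by rewrite /= big_ord0 big_nil.
case/andP=> ww wL; rewrite [LHS]big_sumType /= big_cat !big_map /=; congr (op _ _).
  rewrite -val_enum_ord big_map big_enum /=; apply: eq_bigr => v _.
  apply: inv; apply: iso_trans (switch_inl _ _) _; apply: iso_union (iso_refl _).
  by apply: iso_trans (iso_switch_vertex v) (iso_canon _); apply: well_formed_switch.
rewrite -(IH (fun X => psi (union (necklace w) X))) //; last first.
  by move=> X Y XY; apply: inv; apply: iso_union (iso_refl _) XY.
by apply: eq_bigr => v _; apply/inv/switch_inr.
Qed.

Lemma deck_mult_realize L K : all well_formed L ->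
  deck_mult (realize L) K = \sum_(X <- switchings switchings_word L) iso (realize X) K.
Proof.
move=> wL; rewrite /deck_mult -sum1_card big_mkcond /=.
have inv : iso_invariant (fun X => iso X K : nat).
  by move=> X Y XY; rewrite (iso_congr XY (iso_refl K)).
rewrite -(big_switch_realize _ inv wL); apply: eq_bigr => v _.
by rewrite inE; case: (iso _ _).
Qed.

Lemma deck_mult_iso (G H K : digraph) : iso G H -> deck_mult G K = deck_mult H K.
Proof.
case/isoP=> f [bijf edgef]; rewrite /deck_mult -(card_imset _ (bij_inj bijf)).
apply: eq_card => y; have [g fK gK] := bijf.
rewrite inE -[y]gK (mem_imset _ _ (bij_inj bijf)) inE.
by rewrite (iso_congr (iso_switch _ bijf edgef) (iso_refl K)).
Qed.

(** * Decks of multisets of components *)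

Section MultisetDecks.
Variables (T : eqType) (d : T -> seq T).
Implicit Types (L M R X : seq T) (F : seq T -> nat).

Definition perm_invariant F := forall X Y, perm_eq X Y -> F X = F Y.

Definition deck_sum F L := \sum_(w <- L) \sum_(u <- d w) F (u :: rem w L).

(** Equality of decks as multisets of multisets, tested by numerical functions; each argument below
    chooses an F that counts one feature of the cards. *)
Definition same_deck_sums L L' :=
  forall F, perm_invariant F -> deck_sum F L = deck_sum F L'.

Lemma perm_rem X Y x : perm_eq X Y -> perm_eq (rem x X) (rem x Y).
Proof.
move=> XY; have [xX|xX] := boolP (x \in X); last first.
  by rewrite !rem_id -?(perm_mem XY).
have xY : x \in Y by rewrite -(perm_mem XY).
by rewrite -(perm_cons x) -(permPl (perm_to_rem xX)) -(permPr (perm_to_rem xY)).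
Qed.

Lemma deck_sum_perm F L L' : perm_invariant F -> perm_eq L L' ->
  deck_sum F L = deck_sum F L'.
Proof.
move=> invF LL'; rewrite /deck_sum (perm_big _ LL') /=.
apply: eq_bigr => w _; apply: eq_bigr => u _; apply: invF.
by rewrite perm_cons perm_rem.
Qed.

Lemma deck_sum_switchings F L : perm_invariant F ->
  \sum_(X <- switchings d L) F X = deck_sum F L.
Proof.
rewrite /deck_sum; elim: L F => [|w L IH] F invF; first by rewrite !big_nil.
rewrite /= big_cat big_map big_cons eqxx big_map; congr (_ + _).
rewrite (IH (fun X => F (w :: X))); last by move=> X Y XY; apply: invF; rewrite perm_cons.
rewrite !big_seq; apply: eq_bigr => w' w'L; apply: eq_bigr => u _; apply: invF.
rewrite -[w :: u :: _]/([:: w] ++ [:: u] ++ _) perm_catCA /= perm_cons.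
by case: eqP => [->|_]; rewrite ?perm_refl // perm_sym perm_to_rem.
Qed.

Lemma same_deck_sums_of_count L L' :
  (forall K, count (perm_eq K) (switchings d L) = count (perm_eq K) (switchings d L')) ->
  same_deck_sums L L'.
Proof.
move=> H F invF; rewrite -!deck_sum_switchings //.
elim: (switchings d L) (switchings d L') H => [|X s IH] s' H.
  case: s' H => [|Y s'] H; first by [].
  by have := H Y; rewrite /= perm_refl.
have : has (perm_eq X) s' by rewrite has_count -H /= perm_refl.
case/hasP=> Y Ys' XY; rewrite (perm_big _ (perm_to_rem Ys')) !big_cons (invF _ _ XY).
congr (_ + _); apply: IH => K; have := H K.
rewrite (permP (perm_to_rem Ys')) /= (_ : perm_eq K X = perm_eq K Y); first by lia.
by rewrite (permPr XY).
Qed.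

Lemma common_part L L' : exists R M M',
  [/\ perm_eq L (R ++ M), perm_eq L' (R ++ M') & forall x, x \in M -> x \notin M'].
Proof.
elim: L L' => [|x L IH] L'; first by exists [::], [::], L'; rewrite !perm_refl.
have [xL'|xL'] := boolP (x \in L').
  have [R [M [M' [LR LR' dM]]]] := IH (rem x L').
  exists (x :: R), M, M'; split=> //; first by rewrite perm_cons.
  by rewrite (permPl (perm_to_rem xL')) perm_cons.
have [R [M [M' [LR LR' dM]]]] := IH L'.
exists R, (x :: M), M'; split=> //.
  by rewrite (permPr (permEl (perm_catCA R [:: x] M))) perm_cons.
move=> y; rewrite inE => /orP[/eqP->|/dM//].
by apply: contra xL' => xM'; rewrite (perm_mem LR') mem_cat xM' orbT.
Qed.

Lemma deck_sum_gt0 F L : 0 < deck_sum F L ->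
  exists w u, [/\ w \in L, u \in d w & 0 < F (u :: rem w L)].
Proof.
rewrite lt0n sum_nat_seq_neq0 => /hasP[w wL] /=.
by rewrite sum_nat_seq_neq0 => /hasP[u ud] /=; rewrite -lt0n => F0; exists w, u.
Qed.

Lemma deck_sum_ge1 F L w u : w \in L -> u \in d w -> 0 < F (u :: rem w L) ->
  0 < deck_sum F L.
Proof.
move=> wL ud F0; rewrite /deck_sum (big_rem w) //= (big_rem u) //=.
by rewrite -addnA ltn_addr.
Qed.

Lemma same_deck_sums_match L L' w u : same_deck_sums L L' -> w \in L -> u \in d w ->
  exists w' u', [/\ w' \in L', u' \in d w' & perm_eq (u :: rem w L) (u' :: rem w' L')].
Proof.
move=> same wL ud; pose F X := perm_eq (u :: rem w L) X : nat.
have invF : perm_invariant F by move=> X Y XY; rewrite /F (permPr XY).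
have [|w' [u' [w'L' u'd]]] := @deck_sum_gt0 F L'; last by rewrite /F lt0b => E; exists w', u'.
by rewrite -(same F invF); apply: deck_sum_ge1 wL ud _; rewrite /F perm_refl.
Qed.

Lemma count_rem_mem (x w : T) L : w \in L ->
  count_mem x (rem w L) + (w == x) = count_mem x L.
Proof. by move=> wL; rewrite (permP (perm_to_rem wL)) /= addnC. Qed.

(* With k the multiplicity of c in the common part, compare the elements of   *)
(* the two decks in which c occurs k - 1 times.                               *)
Lemma stable_of_count_le L L' a c u : same_deck_sums L L' ->
  count_mem c L' <= count_mem c L -> count_mem a L' < count_mem a L ->
  c \in L' -> u \in d c -> u = c.
Proof.
move=> same; rewrite leq_eqVlt => /orP[/eqP cLL' aLL' cL' ud|lt _ cL' ud]; last first.
  have same' : same_deck_sums L' L by move=> F invF; rewrite (same F).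
  have [w [u' [wL u'd match_uw]]] := same_deck_sums_match same' cL' ud.
  have := permP match_uw (pred1 c); have := count_rem_mem c wL.
  have := count_rem_mem c cL'; rewrite /= eqxx; case: (u =P c) => // _.
  by move: (u' == c) (w == c) => [] []; lia.
(* With c equally frequent in L and L', the relevant cards come from turning a copy of c into some v
   different from c. Weighted by copies of a, the two totals differ by the surplus of a in L times
   the number of such v, which must vanish. *)
pose F X := (count_mem c X == (count_mem c L).-1) * count_mem a X.
have invF : perm_invariant F by move=> X Y XY; rewrite /F !(permP XY).
have ac : a != c by apply: contraTneq aLL' => ->; rewrite cLL' ltnn.
have c0 : 0 < count_mem c L by rewrite -cLL' -has_count has_pred1.
have E X : count_mem c X = count_mem c L ->
    deck_sum F X = count_mem c L * \sum_(v <- d c | v != c) ((v == a) + count_mem a X).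
  move=> cX; rewrite /deck_sum (bigID (pred1 c)) /= [X in _ + X]big_seq_cond.
  rewrite [X in _ + X]big1 ?addn0; last first.
    move=> w /andP[wX wc]; rewrite big1 // => v _; rewrite /F /=.
    have := count_rem_mem c wX; rewrite (negPf wc) addn0 => ->.
    by rewrite cX; case: eqP; lia.
  rewrite -big_filter (eq_big_seq (fun=> \sum_(v <- d c | v != c) ((v == a) + count_mem a X))).
    by rewrite big_const_seq count_predT iter_addn_0 mulnC size_filter cX.
  move=> w; rewrite mem_filter => /andP[/eqP-> cX'].
  rewrite [RHS]big_mkcond; apply: eq_bigr => v _; rewrite /F /=.
  have -> : count_mem c (rem c X) = (count_mem c L).-1.
    by have := count_rem_mem c cX'; rewrite eqxx cX; lia.
  have -> : count_mem a (rem c X) = count_mem a X.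
    by have := count_rem_mem a cX'; rewrite [c == a]eq_sym (negPf ac) addn0.
  case: (v =P c) => /= _; last by rewrite add0n eqxx mul1n.
  by rewrite add1n (gtn_eqF (ltnSn _)) mul0n.
have := same F invF; rewrite !E // => /eqP; rewrite eqn_pmul2l //.
rewrite !big_split /= eqn_add2l !big_const_seq !iter_addn_0 eqn_mul2r (gtn_eqF aLL') orbF.
apply: contraTeq => uc; rewrite -lt0n -has_count; apply/hasP; by exists u.
Qed.

Lemma stable_common L L' a a' c u : same_deck_sums L L' ->
  count_mem a L' < count_mem a L -> count_mem a' L < count_mem a' L' ->
  c \in L -> c \in L' -> u \in d c -> u = c.
Proof.
move=> same aL a'L' cL cL' ud.
case: (leqP (count_mem c L') (count_mem c L)) => [le|/ltnW le].
  exact: stable_of_count_le same le aL cL' ud.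
by apply: stable_of_count_le le a'L' cL ud => F invF; rewrite (same F).
Qed.

(** Switching inside a stable component returns the whole multiset unchanged; the number of such
    cards is the shift r of the eigenvalue equation. *)
Lemma deck_sum_cat F R M : perm_invariant F ->
  (forall w u, w \in R -> u \in d w -> u = w) ->
  deck_sum F (R ++ M) =
    (\sum_(w <- R) size (d w)) * F (R ++ M) + deck_sum (fun X => F (R ++ X)) M.
Proof.
move=> invF stabR; rewrite /deck_sum big_cat; congr (_ + _).
  rewrite big_distrl /= !big_seq; apply: eq_bigr => w wR.
  rewrite big_seq (eq_bigr (fun=> F (R ++ M))) => [|u ud].
    by rewrite -big_seq big_const_seq count_predT iter_addn_0 mulnC.
  by apply: invF; rewrite (stabR _ _ wR ud) perm_sym perm_to_rem // mem_cat wR.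
rewrite !big_seq; apply: eq_bigr => w wM; apply: eq_bigr => u _; apply: invF.
rewrite perm_sym (permPl (permEl (perm_catCA R [:: u] _))) perm_cons.
rewrite -(perm_cons w) perm_sym -(permPl (perm_to_rem _)); last by rewrite mem_cat wM orbT.
by rewrite -[w :: R ++ _]/([:: w] ++ R ++ _) (permPr (permEl (perm_catCA [:: w] R _))) perm_cat2l perm_to_rem.
Qed.

Lemma perm_foldr_rem X Y R : perm_eq X Y -> perm_eq (foldr (@rem T) X R) (foldr (@rem T) Y R).
Proof. by move=> XY; elim: R => //= x R; apply: perm_rem. Qed.

Lemma foldr_rem_cat R X : perm_eq (foldr (@rem T) (R ++ X) R) X.
Proof.
suff H Y Z : perm_eq Y (R ++ Z) -> perm_eq (foldr (@rem T) Y R) Z by apply: H.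
elim: R Z => [|x R IH] Z //= H.
have {}IH : perm_eq (foldr (@rem T) Y R) (x :: Z).
  by apply: IH; rewrite (permPl H) perm_sym (permPl (permEl (perm_catCA R [:: x] Z))).
by rewrite (permPl (perm_rem x IH)) /= eqxx.
Qed.

(** Every card contains R, so F may be evaluated after R has been removed from the card. *)
Lemma same_deck_sums_reduce L L' R M M' : same_deck_sums L L' ->
  perm_eq L (R ++ M) -> perm_eq L' (R ++ M') ->
  (forall w u, w \in R -> u \in d w -> u = w) ->
  forall F, perm_invariant F ->
    (\sum_(w <- R) size (d w)) * F M + deck_sum F M =
    (\sum_(w <- R) size (d w)) * F M' + deck_sum F M'.
Proof.
move=> same LR LR' stabR F invF.
pose G X := F (foldr (@rem T) X R).
have invG : perm_invariant G by move=> X Y XY; apply: invF; apply: perm_foldr_rem.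
have GE X : G (R ++ X) = F X by apply: invF; apply: foldr_rem_cat.
have := same G invG; rewrite (deck_sum_perm invG LR) (deck_sum_perm invG LR').
rewrite !deck_sum_cat // !GE => E.
have GF X : deck_sum (fun Y => G (R ++ Y)) X = deck_sum F X.
  by rewrite /deck_sum; do 2!apply: eq_bigr => ? _; rewrite GE.
by rewrite -!GF.
Qed.

Lemma perm_size1P (s : seq T) : size s = 1 -> exists a, s = [:: a].
Proof. by case: s => [|a []] // _; exists a. Qed.

(** Write L = R + M and L' = R + M' with M and M' disjoint. [stable_common] makes R stable, one
    common card bounds the size of M by 2, and the two possible sizes give the two alternatives. *)
Theorem same_deck_cases L L' :
  same_deck_sums L L' -> ~~ perm_eq L L' ->
  (forall w, w \in L ++ L' -> d w != [::]) ->
  (exists R a b, [/\ a != b, perm_eq L (a :: R), perm_eq L' (b :: R),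
      forall w u, w \in R -> u \in d w -> u = w &
      perm_eq (nseq (\sum_(w <- R) size (d w)) a ++ d a)
              (nseq (\sum_(w <- R) size (d w)) b ++ d b)]) \/
  (exists a1 a2 b1 b2, [/\ perm_eq L [:: a1; a2], perm_eq L' [:: b1; b2],
      {subset d a1 ++ d a2 <= [:: b1; b2]} & {subset d b1 ++ d b2 <= [:: a1; a2]}]).
Proof.
move=> same nLL' dn0.
have [R [M [M' [LR LR' dM]]]] := common_part L L'.
have cL x : count_mem x L = count_mem x R + count_mem x M.
  by rewrite (permP LR) count_cat.
have cL' x : count_mem x L' = count_mem x R + count_mem x M'.
  by rewrite (permP LR') count_cat.
have dM' x : x \in M' -> x \notin M by move=> xM'; apply/negP=> /dM; rewrite xM'.
have pick w : w \in L ++ L' -> exists u, u \in d w.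
  by move/dn0; case: (d w) => // u s _; exists u; rewrite mem_head.
have [w [u [w' [u' [wL ud w'L' u'd match_uw]]]]] : exists w u w' u',
    [/\ w \in L, u \in d w, w' \in L', u' \in d w' &
        perm_eq (u :: rem w L) (u' :: rem w' L')].
  case EL: L => [|w L0].
    case EL': L' => [|w' L0']; first by rewrite EL EL' in nLL'.
    have w'L' : w' \in L' by rewrite EL' mem_head.
    have [|u' u'd] := pick w'; first by rewrite mem_cat w'L' orbT.
    have [w [u [wL _ _]]] := same_deck_sums_match (fun F i => esym (same F i)) w'L' u'd.
    by rewrite EL in wL.
  have wL : w \in L by rewrite EL mem_head.
  have [|u ud] := pick w; first by rewrite mem_cat wL.
  have [w' [u' [w'L' u'd E]]] := same_deck_sums_match same wL ud.
  by exists w, u, w', u'; rewrite -EL.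
have sizeLL' : size L = size L'.
  have := perm_size match_uw; rewrite /= !size_rem //.
  by move: wL w'L'; case: (L) => // ? ? _; case: (L') => // ? ? _ /=; lia.
have sizeMM' : size M = size M'.
  by have := perm_size LR; have := perm_size LR'; rewrite !size_cat; lia.
(* In the card equality L - w + u = L' - w' + u', an element of M absent from M' can only be
   accounted for by w or u'. *)
have size2 : size M <= 2.
  have /count_subseqP[t tt MM] : forall x, count_mem x M <= count_mem x [:: w; u'].
    move=> x; have := permP match_uw (pred1 x); rewrite /=.
    have := count_rem_mem x wL; have := count_rem_mem x w'L'; rewrite cL cL'.
    have [/count_memPn ->|/negPn/dM] := boolP (x \notin M); first by [].
    move/count_memPn ->; move: (nat_of_bool (w == x)) (nat_of_bool (w' == x)).
    by move: (nat_of_bool (u == x)) (nat_of_bool (u' == x)); lia.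
  by rewrite (perm_size MM); apply: leq_trans (size_subseq tt) _.
have M0 : M != [::].
  apply: contraNneq nLL' => M0; rewrite (permPl LR) (permPr LR') perm_cat2l M0.
  by move: sizeMM'; rewrite M0 => /esym/size0nil ->.
have [a aM] : exists a, a \in M by case: (M) M0 => // a s _; exists a; rewrite mem_head.
have [a' a'M'] : exists a', a' \in M'.
  by case: (M') sizeMM' => [/size0nil/eqP|a' s _]; [rewrite (negPf M0) | exists a'; rewrite mem_head].
have stabR v t : v \in R -> t \in d v -> t = v.
  move=> vR; apply: (@stable_common L L' a a') => //.
  - by rewrite cL cL' ltn_add2l (count_memPn (dM _ aM)) -has_count has_pred1.
  - by rewrite cL cL' ltn_add2l (count_memPn (dM' _ a'M')) -has_count has_pred1.
  - by rewrite (perm_mem LR) mem_cat vR.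
  - by rewrite (perm_mem LR') mem_cat vR.
have red := same_deck_sums_reduce same LR LR' stabR.
have {size2 M0} : size M = 1 \/ size M = 2 by case: (M) M0 size2 => [|? [|? []]] //; auto.
case=> sM.
  left; have [b EM] := perm_size1P sM; have [b' EM'] := perm_size1P (etrans (esym sizeMM') sM).
  exists R, b, b'; split=> //.
  - by have := dM b; rewrite EM EM' !inE eqxx => /(_ isT).
  - by rewrite (permPl LR) EM perm_catC.
  - by rewrite (permPl LR') EM' perm_catC.
  (* Cards of a single component are singletons, so these F compare the multisets of switchings. *)
  - apply/permP => p; pose F X := count p X.
    have invF : perm_invariant F by move=> X Y XY; rewrite /F (permP XY).
    have cnt x t : \sum_(v <- t) F (v :: rem x [:: x]) = count p t.
      rewrite -sum1_count [RHS]big_mkcond; apply: eq_bigr => v _.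
      by rewrite /F /= eqxx /= addn0; case: (p v).
    have := red F invF; rewrite EM EM' /deck_sum !big_seq1 !cnt !count_cat !count_nseq.
    by rewrite /F /= !addn0 ![_ * (p _)]mulnC.
right.
have inner M2 w1 : size M2 = 2 -> w1 \in M2 -> exists2 b, b \in rem w1 M2 & b \in M2.
  move=> s2 w1M; case E: (rem w1 M2) => [|b t].
    by have := size_rem w1M; rewrite E s2.
  by exists b; [rewrite mem_head | apply: (mem_rem (x := w1)); rewrite E mem_head].
have sM' : size M' = 2 by rewrite -sizeMM'.
(* Test with the indicator of M: a card of M' keeps one of its two components, which is not in M, so
   it never equals M. Hence the shift r is 0, and R is empty because each component has a
   switching. *)
have RE : R = [::].
  pose F X := perm_eq M X : nat.
  have invF : perm_invariant F by move=> X Y XY; rewrite /F (permPr XY).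
  have := red F invF; rewrite {1}/F perm_refl muln1 (_ : F M' = 0); last first.
    rewrite /F; case: (boolP (perm_eq M M')) => // MM'.
    by have := dM _ aM; rewrite -(perm_mem MM') aM.
  rewrite muln0 add0n; case: (posnP (deck_sum F M')) => [->|/deck_sum_gt0].
    move/eqP; rewrite addn_eq0 => /andP[+ _]; case ER: R => [//|v R0].
    rewrite big_cons addn_eq0 size_eq0 => /andP[+ _]; rewrite (negPf (dn0 _ _)) //.
    by rewrite mem_cat (perm_mem LR) mem_cat ER mem_head.
  case=> v [t [vM' _]]; rewrite /F lt0b => MM'.
  have [b bv bM'] := inner _ _ sM' vM'.
  by have := dM' _ bM'; rewrite (perm_mem MM') inE bv orbT.
have sameM : same_deck_sums M M'.
  by move=> F invF; have := red F invF; rewrite RE big_nil.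
(* The matching card of M2 retains an element of M2; as it is not in M1, it must be the newly
   switched component t. *)
have sub M1 M2 : same_deck_sums M1 M2 -> size M2 = 2 -> (forall x, x \in M2 -> x \notin M1) ->
    forall v t, v \in M1 -> t \in d v -> t \in M2.
  move=> same12 s2 dis v t vM td.
  have [v' [t' [v'M _ E]]] := same_deck_sums_match same12 vM td.
  have [b bv bM] := inner _ _ s2 v'M.
  have : b \in t :: rem v M1 by rewrite (perm_mem E) inE bv orbT.
  rewrite inE => /orP[/eqP <- //|/mem_rem bM1].
  by have := dis _ bM; rewrite bM1.
have := sub _ _ sameM sM' dM'.
have := sub _ _ (fun F i => esym (sameM F i)) sM dM.
move: LR LR'; rewrite RE /=; case: (M) sM => [|a1 [|a2 []]] // _.
case: (M') sM' => [|b1 [|b2 []]] // _ LR LR' sub1 sub2.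
exists a1, a2, b1, b2; split=> // t; rewrite mem_cat => /orP[] td.
- by apply: sub2 td; rewrite mem_head.
- by apply: sub2 td; rewrite !inE eqxx orbT.
- by apply: sub1 td; rewrite mem_head.
- by apply: sub1 td; rewrite !inE eqxx orbT.
Qed.
End MultisetDecks.

(** * Bounds on the sizes of the differing components *)

Local Notation swd := switchings_word.

Lemma size_switchings_word w : size (swd w) = size w.
Proof. by rewrite size_map size_iota. Qed.

Lemma canonical_switchings_word w : canonical w -> all canonical (swd w).
Proof.
case/andP=> ww _; apply/allP=> u /mapP[v _ ->].
exact/canonical_canon/well_formed_switch.
Qed.

Lemma canonical_well_formed L : all canonical L -> all well_formed L.
Proof. by apply: sub_all => w /andP[]. Qed.

Lemma canonical_switchings L : all canonical L ->
  forall X, X \in switchings swd L -> all canonical X.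
Proof.
elim: L => [|w L IH] //= /andP[cw cL] X; rewrite mem_cat => /orP[] /mapP[u uP ->] /=.
  by rewrite cL (allP (canonical_switchings_word cw)).
by rewrite cw IH.
Qed.

Lemma same_deck_realize L L' : all canonical L -> all canonical L' ->
  same_deck (realize L) (realize L') -> same_deck_sums swd L L'.
Proof.
move=> cL cL' same; apply: same_deck_sums_of_count => K.
have zero M : all canonical M -> ~~ all canonical K ->
    count (perm_eq K) (switchings swd M) = 0.
  move=> cM; apply: contraNeq; rewrite -lt0n -has_count => /hasP[X /(canonical_switchings cM) cX KX].
  by rewrite (perm_all _ KX).
have [cK|ncK] := boolP (all canonical K); last by rewrite !zero.
have E M : all canonical M ->
    deck_mult (realize M) (realize K) = count (perm_eq K) (switchings swd M).
  move=> cM; rewrite deck_mult_realize; last exact: canonical_well_formed.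
  rewrite -sum1_count [RHS]big_mkcond big_seq [RHS]big_seq; apply: eq_bigr => X XM.
  have cX := canonical_switchings cM XM.
  by rewrite (realize_iso cX cK) perm_sym; case: (perm_eq _ _).
by rewrite -!E.
Qed.

Lemma big_switch_necklace (V : Type) (idx : V) (op : Monoid.com_law idx)
    (psi : digraph -> V) w : iso_invariant psi -> well_formed w ->
  \big[op/idx]_(v : necklace w) psi (switch v) =
  \big[op/idx]_(u <- swd w) psi (necklace u).
Proof.
move=> inv ww; rewrite big_map -val_enum_ord big_map big_enum /=; apply: eq_bigr => v _.
by apply: inv; apply: iso_trans (iso_switch_vertex v) (iso_canon _); apply: well_formed_switch.
Qed.

Lemma size_dihedral w : size (dihedral w) = 2 * size w.
Proof. by rewrite size_cat !size_map !size_iota addnn mul2n. Qed.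

Lemma orbit_size_le w : orbit_size w <= 2 * size w.
Proof. by rewrite -size_dihedral /orbit_size size_filter count_size. Qed.

Lemma eigen_pair_bound a b r : canonical a -> canonical b -> a != b ->
  perm_eq (nseq r a ++ swd a) (nseq r b ++ swd b) ->
  2 ^ size a <= (4 * orbit_size a) ^ 2.
Proof.
move=> ca cb ab pab.
have [wa wb] : well_formed a /\ well_formed b by case/andP: ca; case/andP: cb.
have sab : size a = size b.
  have := perm_size pab; rewrite !size_cat !size_nseq !size_switchings_word.
  by move/eqP; rewrite eqn_add2l => /eqP.
have := @switching_bound (necklace a) (necklace b) r.
rewrite canonical_iso // !card_ord => H; apply: leq_trans (H sab ab _) _.
  move=> psi inv; rewrite !big_switch_necklace //.
  have cnt w : (\sum_(u <- swd w) psi (necklace u) + r%:R * psi (necklace w))%R =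
      (\sum_(u <- nseq r w ++ swd w) psi (necklace u))%R.
    rewrite big_cat big_nseq /= addrC mulr_natl; congr (_ + _)%R.
    by elim: (r) => //= k <-; rewrite mulrS.
  by rewrite !cnt; apply: perm_big.
rewrite leq_exp2r // (_ : 4 * orbit_size a = 2 * orbit_size a + 2 * orbit_size a); last by lia.
by apply: leq_add; apply: card_switch_set_iso.
Qed.

(** The 64 m^2 is (4 * 2m)^2, from [eigen_pair_bound] with [orbit_size] at most 2m. *)
Lemma exp2_gt m : 14 <= m -> 64 * m ^ 2 < 2 ^ m.
Proof.
elim: m => // m IH; rewrite leq_eqVlt => /orP[/eqP <-|lt].
  rewrite -(ltn_pmul2r (isT : 0 < 1)) !muln1.
  by rewrite (_ : 2 ^ 14 = 2 ^ 7 * 2 ^ 7) // -expnD.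
have {IH} := IH lt; rewrite [2 ^ m.+1]expnS; move: (2 ^ m) => x.
rewrite !expnS !expn0 !muln1 => H.
have : m.+1 * m.+1 <= 2 * (m * m) by nia.
by move: (m * m) (m.+1 * m.+1) H => y z; lia.
Qed.

(** With at most two well-formed words the bound reads 2^m <= 8^2. The second conjunct thereby
    removes paths on more than 6 vertices from the search. *)
Lemma eigen_pair_small a b r : canonical a -> canonical b -> a != b ->
  perm_eq (nseq r a ++ swd a) (nseq r b ++ swd b) ->
  size a <= 13 /\ (size a <= 6) || (2 < orbit_size a).
Proof.
move=> ca cb ab pab; have bound := eigen_pair_bound ca cb ab pab; split.
  rewrite leqNgt; apply/negP => /exp2_gt; apply/negP; rewrite -leqNgt.
  apply: leq_trans bound _; rewrite expnMn.
  have le := orbit_size_le a; have : orbit_size a ^ 2 <= (2 * size a) ^ 2 by rewrite leq_exp2r.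
  by rewrite expnMn; move: (orbit_size a ^ 2) (size a ^ 2) => x y; lia.
case: ltnP => [|o2]; first by rewrite orbT.
rewrite orbF -ltnS -(ltn_exp2l _ _ (isT : 1 < 2)).
apply: leq_ltn_trans bound _; apply: leq_ltn_trans (_ : (4 * 2) ^ 2 < _) => //.
by rewrite leq_exp2r // leq_mul2l.
Qed.

(** All 2^m switchings of a stay in the closed list s, and each class in s is reached from at most
    4m vertex sets. *)
Lemma switch_closed_bound a (s : seq (seq (option bool))) :
  canonical a -> all canonical s -> a \in s ->
  (forall w u, w \in s -> u \in swd w -> u \in s) ->
  2 ^ size a <= size s * (4 * size a).
Proof.
move=> ca cs a_s closed.
have [wa _] := andP ca.
pose good (X : digraph) := has (fun w => iso X (necklace w)) s.
have good_switch (X : digraph) (v : X) : good X -> good (switch v).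
  case/hasP=> w ws /isoP[f [bijf edgef]]; have ww := canonical_well_formed cs.
  apply/hasP; exists (canon (switch_word (pred1 (f v : nat)) w)).
    apply: (closed w) => //; apply/mapP; exists (f v : nat) => //.
    by rewrite mem_iota ltn_ord.
  apply: iso_trans (iso_switch v bijf edgef) _.
  apply: iso_trans (iso_switch_vertex (f v)) (iso_canon _).
  by apply: well_formed_switch; apply: (allP ww).
have good_iso (X Y : digraph) : iso X Y -> good X -> good Y.
  move=> XY /hasP[w ws Xw]; apply/hasP; exists w => //.
  by apply: iso_trans Xw; rewrite iso_sym.
have good_set (S : {set necklace a}) : good (switch_set S).
  move: {2}#|S| (erefl #|S|) => n; elim: n S => [|n IH] S.
    move/eqP; rewrite cards_eq0 => /eqP->; apply/hasP; exists a => //.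
    exact: switch_set0.
  move=> cS; have /card_gt0P[v vS] : 0 < #|S| by rewrite cS.
  have := good_switch _ (v : switch_set (symdiff S [set v])) (IH (symdiff S [set v]) _).
  rewrite card_symdiff1 vS cS => /(_ erefl); apply: good_iso.
  by apply: iso_trans (switch_switch_set _ _) _; rewrite (symdiffK [set v] S) iso_refl.
have -> : 2 ^ size a = #|[set: {set necklace a}]|.
  by rewrite -powersetT card_powerset cardsT card_ord.
apply: leq_trans (_ : \sum_(w <- s) #|[set S : {set necklace a} | iso (switch_set S) (necklace w)]| <= _).
  apply: leq_trans (_ : #|\bigcup_(w <- s) [set S : {set necklace a} | iso (switch_set S) (necklace w)]| <= _).
    apply: subset_leq_card; apply/subsetP=> S _.
    have /hasP[w ws Sw] := good_set S.
    by rewrite (big_rem w) //= inE inE Sw.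
  elim: (s) => [|w t IH]; first by rewrite !big_nil cards0.
  rewrite !big_cons; apply: leq_trans (leq_of_leqif (leq_card_setU _ _)) _.
  by rewrite leq_add2l.
rewrite -sum1_size big_distrl /= !big_seq; apply: leq_sum => w ws; rewrite mul1n.
have cw : canonical w by apply: (allP cs).
have [wsz|wsz] := eqVneq (size w) (size a).
  apply: leq_trans (card_switch_set_iso wa _) _; first by case/andP: cw.
  by have := orbit_size_le w; rewrite wsz; lia.
rewrite (_ : [set _ | _] = set0) ?cards0 //; apply/setP=> S; rewrite !inE.
by apply: contraNF wsz => /iso_card; rewrite !card_ord => ->.
Qed.

(** The four words form a closed list, so 2^m <= 16 m, which already fails at m = 7. *)
Lemma two_component_small a1 a2 b1 b2 :
  all canonical [:: a1; a2; b1; b2] ->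
  {subset swd a1 ++ swd a2 <= [:: b1; b2]} ->
  {subset swd b1 ++ swd b2 <= [:: a1; a2]} ->
  all (fun w => size w <= 6) [:: a1; a2; b1; b2].
Proof.
move=> cs sub1 sub2; apply/allP=> w ws.
have /= H := @switch_closed_bound w _ (allP cs _ ws) cs ws.
have {H} : 2 ^ size w <= 4 * (4 * size w).
  apply: H => v u; rewrite !inE => /or4P[] /eqP-> uv.
  - by have := sub1 u; rewrite mem_cat uv !inE => /(_ isT) /orP[] ->; rewrite /= ?orbT.
  - by have := sub1 u; rewrite mem_cat uv orbT !inE => /(_ isT) /orP[] ->; rewrite /= ?orbT.
  - by have := sub2 u; rewrite mem_cat uv !inE => /(_ isT) /orP[] ->; rewrite /= ?orbT.
  - by have := sub2 u; rewrite mem_cat uv orbT !inE => /(_ isT) /orP[] ->; rewrite /= ?orbT.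
move=> H; rewrite leqNgt; apply/negP => lt; move: H; apply/negP; rewrite -ltnNge.
elim: (size w) lt => // m IH; rewrite leq_eqVlt => /orP[/eqP <- //|lt].
by have := IH lt; rewrite expnS; move: (2 ^ m) => x; lia.
Qed.

(** * The table in terms of words *)

Definition letter_of_sign (s : sign) : option bool :=
  if s is Plus then Some true else Some false.

(** A one-element list, so that disjoint union of digraphs becomes concatenation of codes. *)
Definition path_code (w : word) := [:: rcons (map letter_of_sign (letters w)) None].

Definition cycle_code (w : word) := [:: map letter_of_sign (letters w)].

Definition codes (G : digraph) (L : seq (seq (option bool))) : Prop :=
  all well_formed L /\ iso G (realize L).

Lemma realize1 w : iso (necklace w) (realize [:: w]).
Proof.
rewrite iso_sym; apply: iso_trans (iso_unionC _ _) _; exact: iso_union0.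
Qed.

Lemma codes_path w : codes (P w) (path_code w).
Proof.
set u := rcons (map letter_of_sign (letters w)) None.
have szu : size u = (size (letters w)).+1 by rewrite size_rcons size_map.
have nthu i : nth None u i =
    if i < size (letters w) then Some (is_plus w i) else None.
  rewrite nth_rcons size_map; case: ltnP => [lti|_]; last by case: eqP.
  by rewrite (nth_map Minus) // /is_plus; case: (nth _ _ _).
split.
  rewrite /= andbT; apply/well_formedP; rewrite szu; split=> // [i /= lti|].
    by rewrite nthu lti.
  by rewrite /= nthu ltnn.
apply: iso_trans (realize1 u); rewrite iso_sym; apply: iso_trans (necklace_funE szu) _.
apply: iso_edges => i j; rewrite !nthu.
have E (a b : 'I_(size (letters w)).+1) (x : bool) :
    (b == ordS a) && ((if a < size (letters w) then Some (is_plus w a) else None) == Some x)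
    = (b == a.+1 :> nat) && (is_plus w a == x).
  have lta := ltn_ord a; have ltb := ltn_ord b.
  rewrite -(inj_eq val_inj) [val (ordS a)]val_ordS eqSS.
  case: ltnP => H; first by rewrite (ltn_eqF H).
  by rewrite andbF; case: eqP => // E; move: ltb; rewrite E ltnS ltnNge H.
by rewrite !E eqb_id eqbF_neg.
Qed.

Lemma codes_cycle w : 2 < size (letters w) -> codes (C w) (cycle_code w).
Proof.
move=> n2; set u := map letter_of_sign (letters w).
have szu : size u = size (letters w) by rewrite size_map.
have nthu i : i < size (letters w) -> nth None u i = Some (is_plus w i).
  by move=> lti; rewrite (nth_map Minus) // /is_plus; case: (nth _ _ _).
split.
  rewrite /= andbT; apply/well_formedP; rewrite szu n2 orbT; split=> // [|i lti].
    exact: ltnW (ltnW n2).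
  by rewrite nthu // (leq_trans lti) // leq_pred.
apply: iso_trans (realize1 u); rewrite iso_sym; apply: iso_trans (necklace_funE szu) _.
by apply: iso_edges => i j; rewrite !nthu ?ltn_ord //; case: (is_plus w i); case: (is_plus w j).
Qed.

Lemma codes_union_cons G H w M :
  codes G [:: w] -> codes H M -> codes (union G H) (w :: M).
Proof.
rewrite /codes /= andbT => -[ww iw] [wM iM]; split; first by rewrite ww.
by apply: iso_union iM; apply: iso_trans iw _; rewrite iso_sym; apply: realize1.
Qed.

Definition normalize (L : seq (seq (option bool))) := sort lex_le (map canon L).

Lemma codes_normalize G L : codes G L ->
  all canonical (normalize L) /\ iso G (realize (normalize L)).
Proof.
move=> [wL iL]; split.
  rewrite all_sort all_map; apply: sub_all wL; exact: canonical_canon.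
apply: iso_trans iL _; apply: iso_trans (realize_perm (_ : perm_eq (map canon L) _)); last first.
  by rewrite perm_sym; apply: permEl; apply: perm_sort.
elim: L wL => [|w L IH] /=; first by move=> _; apply: iso_refl.
by case/andP=> ww wL; apply: iso_union (iso_canon ww) (IH wL).
Qed.

(** The image of [table] under these codes in normal form, on which isomorphism and equality of
    decks are decided by computation. *)
Definition word_table : seq (seq (seq (seq (option bool)))) :=
  map (map normalize)
  ([:: [:: path_code "++" ++ path_code ""; path_code "+-" ++ path_code ""; path_code "-+" ++ path_code ""];
      [:: path_code "+++"; path_code "+-+"];
      [:: path_code "++-"; path_code "--+"];
      [:: cycle_code "+++" ++ path_code ""; cycle_code "++-" ++ path_code ""];
      [:: cycle_code "++++"; cycle_code "+-+-"]]
  ++ [seq [:: AB.1 ++ T; AB.2 ++ T]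
     | AB <- [:: (cycle_code "+++---", cycle_code "+++++-");
                 (cycle_code "-++-++", cycle_code "-+-+++");
                 (cycle_code "++-+--", cycle_code "++--+-")],
       T <- [:: path_code "" ++ path_code ""; path_code "+"]]
  ++ [:: [:: cycle_code "+++-+--" ++ path_code ""; cycle_code "+++--+-" ++ path_code ""];
         [:: cycle_code "+++++++-"; cycle_code "+++++---"];
         [:: cycle_code "+++-+-+-"; cycle_code "++-++-+-"];
         [:: cycle_code "++--+-+-"; cycle_code "++-+-+--"];
         [:: cycle_code "+++--+--"; cycle_code "+++++-+-"];
         [:: cycle_code "++++-++-"; cycle_code "+++---+-"; cycle_code "+++-+---"];
         [:: cycle_code "++++-+--"; cycle_code "++++--+-"; cycle_code "+++--++-"; cycle_code "+++-++--"];
         [:: path_code "+++" ++ path_code "+-+"; path_code "+--" ++ path_code "--+"];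
         [:: cycle_code "++++" ++ cycle_code "+-+-"; cycle_code "++--" ++ cycle_code "++--"]]).

Definition normal_codes (G : digraph) (L : seq (seq (option bool))) : Prop :=
  all canonical L /\ iso G (realize L).

Lemma table_codes : List.Forall2 (List.Forall2 normal_codes) table word_table.
Proof.
rewrite /table /word_table /=.
by repeat match goal with
  | |- List.Forall2 _ _ _ => constructor
  | |- normal_codes _ _ => apply: codes_normalize
  | |- codes (union _ _) _ => apply: codes_union_cons
  | |- codes (C _) _ => exact: codes_cycle
  | |- codes _ _ => exact: codes_path
  end.
Qed.

(** * Finite search *)

(* [&&] and [||] evaluate both sides under call by value, hence the [if]s. *)
Fixpoint all_lazy (T : Type) (p : T -> bool) (s : seq T) : bool :=
  if s is x :: s' then if p x then all_lazy p s' else false else true.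

Lemma all_lazyE (T : Type) (p : T -> bool) s : all_lazy p s = all p s.
Proof. by elim: s => //= x s ->; case: (p x). Qed.

Fixpoint eq_lazy (u w : seq (option bool)) : bool :=
  match u, w with
  | [::], [::] => true
  | x :: u', y :: w' => if x == y then eq_lazy u' w' else false
  | _, _ => false
  end.

Lemma eq_lazyE u w : eq_lazy u w = (u == w).
Proof.
by elim: u w => [|x u IH] [|y w] //=; rewrite IH eqseq_cons; case: (x == y).
Qed.

Fixpoint mem_lazy (u : seq (option bool)) (s : seq (seq (option bool))) : bool :=
  if s is w :: s' then if eq_lazy u w then true else mem_lazy u s' else false.

Lemma mem_lazyE u s : mem_lazy u s = (u \in s).
Proof. by elim: s => //= w s ->; rewrite eq_lazyE inE; case: (u == w). Qed.

Fixpoint full_words (n : nat) : seq (seq (option bool)) :=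
  if n is n'.+1 then
    map (cons (Some true)) (full_words n') ++ map (cons (Some false)) (full_words n')
  else [:: [::]].

Definition all_words (n : nat) :=
  map (rcons^~ None) (full_words n.-1) ++ (if 2 < n then full_words n else [::]).

Lemma full_wordsP w : all isSome w -> w \in full_words (size w).
Proof.
elim: w => //= -[[]|] w IH //= /IH ws; rewrite mem_cat; apply/orP; [left | right];
  by apply/mapP; exists w.
Qed.

Lemma all_wordsP w : well_formed w -> w \in all_words (size w).
Proof.
case/and3P; case/lastP: w => // u x _; rewrite size_rcons /= -cats1 take_size_cat // cats1.
rewrite last_rcons => su lastx; rewrite mem_cat; case: x lastx => [b|_].
  rewrite orFb => n2; rewrite n2 -(size_rcons u (Some b)) full_wordsP ?orbT //.
  by rewrite all_rcons.
by apply/orP; left; apply/mapP; exists u => //; apply: full_wordsP.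
Qed.

Definition minimal_rotations (w u : seq (option bool)) : bool :=
  all_lazy (fun k => let v := rot k u in if well_formed v then lex_le w v else true)
           (iota 0 (size u)).

(** A cheap necessary condition for the words to be searched: long paths are dropped, and w must be
    least among its well-formed rotations and reflections. *)
Definition candidate (w : seq (option bool)) : bool :=
  if (6 < size w) && (last None w == None) then false else
  if minimal_rotations w w then minimal_rotations w (backward w) else false.

Definition candidates n := [seq w <- all_words n | candidate w].

(** The gap must stand last. This leaves rotation 0 of w and rotation 1 of [backward w], which
    begins with the gap. *)
Lemma orbit_size_path w : 1 < size w -> last None w = None -> orbit_size w <= 2.
Proof.
move=> n1 lastw; rewrite -nth_last in lastw.
have not_wf u k i : size u = size w -> k < size w -> i < (size w).-1 ->
    nth None u ((i + k) %% size w) = None -> ~~ well_formed (rot k u).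
  move=> su ltk lti E; apply/negP => wfr; have := well_formed_nth (i := i) wfr.
  rewrite size_rot su nth_rot su; [|exact: ltnW|by lia].
  by rewrite E => /(_ lti).
rewrite /orbit_size filter_cat size_cat !size_filter !count_map.
have one (p : pred nat) j : (forall k, k < size w -> k != j -> ~~ p k) ->
    count p (iota 0 (size w)) <= 1.
  move=> H; have -> : count p (iota 0 (size w)) = count (predI p (pred1 j)) (iota 0 (size w)).
    apply: eq_in_count => k; rewrite mem_iota => /andP[_ ltk] /=.
    case: (eqVneq k j) => [_|kj]; first by rewrite andbT.
    by rewrite andbF; apply/negbTE/H.
  apply: leq_trans (_ : count (pred1 j) (iota 0 (size w)) <= 1).
    by apply: sub_count => k /andP[].
  by rewrite count_uniq_mem ?iota_uniq // leq_b1.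
apply: (@leq_add _ _ 1 1); [apply: (one _ 0) | apply: (one _ 1)] => k ltk k0 /=.
  apply: (not_wf w k ((size w).-1 - k)) => //; first by lia.
  by rewrite subnK; [rewrite modn_small ?ltn_predL // ltnW | lia].
have b0 : nth None (backward w) 0 = None.
  rewrite nth_rev ?size_map; last exact: ltnW.
  by rewrite (nth_map None) ?subn1 ?lastw // ltn_predL ltnW.
case: k ltk k0 => [|k] ltk k0.
  apply: (not_wf _ _ 0) => //; [exact: size_backward | by lia|].
  by rewrite mod0n.
apply: (not_wf _ _ (size w - k.+1)) => //; [exact: size_backward | by lia|].
by rewrite subnK ?modnn // ltnW.
Qed.

Lemma candidatesP w : canonical w -> (size w <= 6) || (2 < orbit_size w) ->
  w \in candidates (size w).
Proof.
case/andP=> ww /eqP cw ow; rewrite mem_filter all_wordsP // andbT /candidate.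
case: ifP => [/andP[n6 /eqP lastw]|_].
  move: ow; rewrite leqNgt n6 ltnNge orbit_size_path //.
  by apply: leq_trans n6.
have minw u : u \in dihedral w -> (if well_formed u then lex_le w u else true).
  move=> uw; case: ifP => // wu; rewrite -cw; apply: (foldr_lex_min _ _).2.
  by rewrite inE mem_filter wu uw orbT.
rewrite /minimal_rotations !all_lazyE size_backward.
rewrite (_ : all _ _); last first.
  apply/allP=> k; rewrite mem_iota => ltk; apply: minw.
  by rewrite mem_cat; apply/orP; left; apply/mapP; exists k; rewrite ?mem_iota.
apply/allP=> k; rewrite mem_iota => ltk; apply: minw.
by rewrite mem_cat; apply/orP; right; apply/mapP; exists k; rewrite ?mem_iota.
Qed.

Definition in_table (L L' : seq (seq (option bool))) : bool :=
  has (fun row => (sort lex_le L \in row) && (sort lex_le L' \in row)) word_table.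

(** The possible common parts of order r at most 2: nothing, K_1, two copies of K_1, or one directed
    edge. *)
Definition stable_parts (r : nat) : seq (seq (seq (option bool))) :=
  match r with
  | 0 => [:: [::]]
  | 1 => [:: path_code ""]
  | 2 => [:: path_code "" ++ path_code ""; path_code "+"]
  | _ => [::]
  end.

(** For distinct a and b, counting a on both sides of the eigenvalue equation determines r, so r is
    computed and not searched for. The first test is a quick filter. *)
Definition check_pair (a : seq (option bool)) da b db : bool :=
  if all_lazy (fun u => mem_lazy u (b :: db)) da then
    let r := count_mem a db - count_mem a da in
    if perm_eq (nseq r a ++ da) (nseq r b ++ db) then
      (r <= 2) && all (fun R => in_table (a :: R) (b :: R)) (stable_parts r)
    else true
  else true.

Fixpoint check_pairs (s : seq (seq (option bool) * seq (seq (option bool)))) : bool :=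
  if s is p :: s' then
    if all_lazy (fun q => check_pair p.1 p.2 q.1 q.2) s' then check_pairs s' else false
  else true.

Definition check_size (n : nat) : bool :=
  check_pairs [seq (w, swd w) | w <- candidates n].

Lemma check_sizes : all check_size (iota 1 13).
Proof. by vm_compute. Qed.

Definition same_normal_deck (L L' : seq (seq (option bool))) : bool :=
  perm_eq [seq sort lex_le X | X <- switchings swd L]
          [seq sort lex_le X | X <- switchings swd L'].

Definition subset_lazy (s t : seq (seq (option bool))) := all_lazy (mem_lazy^~ t) s.

(** In the two-against-two case the switchings of each component lie among the two components of the
    other side. *)
Definition small_words : seq (seq (option bool)) :=
  [seq w <- flatten [seq candidates n | n <- iota 1 6] | size (undup (swd w)) <= 2].

(** The choice of a2 comes last, so that the switchings of a1 prune the search beforehand. *)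
Definition check_quadruples : bool :=
  let c := [seq (w, swd w) | w <- small_words] in
  all_lazy (fun a1 => all_lazy (fun b1 => all_lazy (fun b2 =>
    if subset_lazy a1.2 [:: b1.1; b2.1] then all_lazy (fun a2 =>
      if subset_lazy a2.2 [:: b1.1; b2.1] then
        if subset_lazy (b1.2 ++ b2.2) [:: a1.1; a2.1] then
          let L := [:: a1.1; a2.1] in let L' := [:: b1.1; b2.1] in
          [|| perm_eq L L', ~~ same_normal_deck L L' | in_table L L']
        else true else true) c else true) c) c) c.

Lemma check_quadruplesT : check_quadruples.
Proof. by vm_compute. Qed.

Lemma sort_lexP L L' : reflect (sort lex_le L = sort lex_le L') (perm_eq L L').
Proof. exact: (perm_sortP lex_le_total lex_le_trans lex_le_anti). Qed.

Lemma table_canonical : all (all (all canonical)) word_table.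
Proof. by vm_compute. Qed.

Lemma table_sorted : all (all (fun L => sort lex_le L == L)) word_table.
Proof. by vm_compute. Qed.

Lemma table_uniq : uniq (flatten word_table).
Proof. by vm_compute. Qed.

Lemma table_decks :
  all (fun row => all (fun L => all (same_normal_deck L) row) row) word_table.
Proof. by vm_compute. Qed.

Lemma table_shape : all (fun row => [&& 1 < size row,
    all (fun L => sumn (map size L) == sumn (map size (head [::] row))) row
    & (sumn (map size (head [::] row)), size row) \in
        [:: (4, 2); (4, 3); (8, 2); (8, 3); (8, 4)]]) word_table.
Proof. by vm_compute. Qed.

Lemma same_deck_sums_normal L L' :
  same_deck_sums swd L L' -> same_normal_deck L L'.
Proof.
move=> same; apply/permP => p; rewrite !count_map.
have invF : perm_invariant (fun X : seq (seq (option bool)) => p (sort lex_le X) : nat).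
  by move=> X Y /sort_lexP ->.
have cnt M : count (preim (sort lex_le) p) (switchings swd M) =
    deck_sum swd (fun X => p (sort lex_le X) : nat) M.
  rewrite -deck_sum_switchings // -sum1_count big_mkcond /=.
  by apply: eq_bigr => X _; case: (p _).
by rewrite !cnt; apply: same.
Qed.

Lemma same_normal_deck_realize L L' : all canonical L -> all canonical L' ->
  same_normal_deck L L' -> same_deck (realize L) (realize L').
Proof.
move=> cL cL' same K; rewrite !deck_mult_realize ?canonical_well_formed //.
have E M : \sum_(X <- switchings swd M) (iso (realize X) K : nat) =
    \sum_(X <- [seq sort lex_le X | X <- switchings swd M]) iso (realize X) K.
  rewrite big_map; apply: eq_bigr => X _; congr nat_of_bool.
  apply: iso_congr (iso_refl K); apply: realize_perm.
  by rewrite perm_sym; apply: permEl; apply: perm_sort.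
by rewrite !E; apply: perm_big.
Qed.

Lemma check_pairsP s p q : check_pairs s -> p \in s -> q \in s -> p != q ->
  check_pair p.1 p.2 q.1 q.2 || check_pair q.1 q.2 p.1 p.2.
Proof.
elim: s => //= t s IH; rewrite all_lazyE; case: ifP => // /allP ts /IH {}IH.
rewrite !inE => /orP[/eqP->|ps] /orP[/eqP->|qs].
- by rewrite eqxx.
- by rewrite ts.
- by rewrite ts ?orbT.
- exact: IH.
Qed.

Lemma in_tableC L L' : in_table L L' = in_table L' L.
Proof. by apply: eq_has => row; rewrite andbC. Qed.

Lemma in_table_perm L L' M M' : perm_eq L M -> perm_eq L' M' ->
  in_table L L' = in_table M M'.
Proof. by move=> /sort_lexP LM /sort_lexP LM'; rewrite /in_table LM LM'. Qed.

(** The check itself asserts r <= 2, so the alternative 2 < r is contradictory and no prior bound on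
    the common part R is required. *)
Lemma check_pair_spec a b r : a != b ->
  perm_eq (nseq r a ++ swd a) (nseq r b ++ swd b) ->
  check_pair a (swd a) b (swd b) ->
  forall R, (exists2 R', R' \in stable_parts r & perm_eq R R') \/ 2 < r ->
  in_table (a :: R) (b :: R).
Proof.
move=> ab pab; rewrite /check_pair all_lazyE.
have -> : all (mem_lazy^~ (b :: swd b)) (swd a).
  apply/allP=> u ua; rewrite mem_lazyE inE.
  have : u \in nseq r b ++ swd b by rewrite -(perm_mem pab) mem_cat ua orbT.
  by rewrite mem_cat mem_nseq => /orP[/andP[_ ->]|->]; rewrite ?orbT.
have -> : count_mem a (swd b) - count_mem a (swd a) = r.
  have := permP pab (pred1 a); rewrite !count_cat !count_nseq /= eqxx.
  by rewrite eq_sym (negPf ab) mul1n mul0n; lia.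
rewrite pab => /andP[r2 /allP inT] R [[R' R'r RR']|]; last by rewrite ltnNge r2.
by rewrite (in_table_perm (_ : perm_eq _ (a :: R')) (_ : perm_eq _ (b :: R'))) ?perm_cons ?inT.
Qed.

Lemma stable_partsP R : all canonical R ->
  let r := \sum_(w <- R) size (swd w) in r <= 2 ->
  exists2 R', R' \in stable_parts r & perm_eq R R'.
Proof.
have size1 w : canonical w -> size w = 1 -> w = [:: None].
  by case: w => [|[[]|] []].
have size2 w : canonical w -> size w = 2 -> w = [:: Some true; None].
  by case: w => [|[[]|] [|[[]|] []]].
have pos w : canonical w -> 0 < size w by case/andP => /and3P[].
case: R => [|w [|w' [|w'' R]]] /=; first by rewrite big_nil; exists [::].
- rewrite andbT big_seq1 size_switchings_word => cw.
  case sw: (size w) (pos _ cw) => [|[|[|]]] // _ _.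
    by rewrite (size1 _ cw sw); exists [:: [:: None]].
  by rewrite (size2 _ cw sw); exists [:: [:: Some true; None]].
- rewrite andbT !big_cons big_nil !size_switchings_word addn0 => /andP[cw cw'].
  case sw: (size w) (pos _ cw) => [|[|k]] // _; case sw': (size w') (pos _ cw') => [|[|k']] // _;
    rewrite ?addSn ?addnS //= => _.
  by rewrite (size1 _ cw sw) (size1 _ cw' sw'); exists [:: [:: None]; [:: None]].
case/and4P=> cw cw' cw'' _; rewrite !big_cons !size_switchings_word.
by have := pos _ cw; have := pos _ cw'; have := pos _ cw''; lia.
Qed.

Theorem same_deck_classification L L' : all canonical L -> all canonical L' ->
  same_deck (realize L) (realize L') -> ~~ perm_eq L L' -> in_table L L'.
Proof.
move=> cL cL' /same_deck_realize same nLL'.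
have {same} sums := same cL cL'.
have c_all w : w \in L ++ L' -> canonical w.
  by rewrite mem_cat => /orP[]; [move/(allP cL) | move/(allP cL')].
have dn0 w : w \in L ++ L' -> swd w != [::].
  move=> /c_all /andP[/and3P[w0 _ _] _]; apply: contraTneq w0.
  by move/(congr1 size); rewrite size_switchings_word => ->.
case: (same_deck_cases sums nLL' dn0).
  case=> R [a [b [ab LR LR' stabR pab]]]; rewrite (in_table_perm LR LR').
  set r := \sum_(w <- R) _ in pab.
  have : all canonical (a :: R) by rewrite -(perm_all _ LR).
  case/andP=> ca cR; have : all canonical (b :: R) by rewrite -(perm_all _ LR').
  case/andP=> cb _.
  have [a13 aorb] := eigen_pair_small ca cb ab pab.
  have ba : b != a by rewrite eq_sym.
  have pba : perm_eq (nseq r b ++ swd b) (nseq r a ++ swd a) by rewrite perm_sym.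
  have [_ borb] := eigen_pair_small cb ca ba pba.
  have sab : size a = size b.
    have := perm_size pab; rewrite !size_cat !size_nseq !size_switchings_word.
    by move/eqP; rewrite eqn_add2l => /eqP.
  have ac := candidatesP ca aorb; have bc := candidatesP cb borb.
  have : check_size (size a).
    apply: (allP check_sizes); rewrite mem_iota.
    by case/andP: ca => /and3P[-> _ _] _; rewrite ltnS.
  have RP : (exists2 R', R' \in stable_parts r & perm_eq R R') \/ 2 < r.
    by case: (leqP r 2) => [/(stable_partsP cR)|]; [left | right].
  move/check_pairsP => /(_ (a, swd a) (b, swd b)).
  rewrite !(map_f (fun w => (w, swd w))) //; last by rewrite sab.
  rewrite xpair_eqE (negPf ab) => /(_ isT isT isT) /= /orP[] H.
    exact: check_pair_spec ab pab H _ RP.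
  by rewrite in_tableC; apply: check_pair_spec ba pba H _ RP.
case=> a1 [a2 [b1 [b2 [LA LB sub1 sub2]]]]; rewrite (in_table_perm LA LB).
have cs : all canonical [:: a1; a2; b1; b2].
  apply/allP=> w; rewrite -[[:: a1; a2; b1; b2]]/([:: a1; a2] ++ [:: b1; b2]) mem_cat.
  by rewrite -(perm_mem LA) -(perm_mem LB) -mem_cat; apply: c_all.
have small := two_component_small cs sub1 sub2.
have sub_small w (t : seq (seq (option bool))) : w \in [:: a1; a2; b1; b2] -> {subset swd w <= t} -> size t <= 2 ->
    (w, swd w) \in [seq (w, swd w) | w <- small_words].
  move=> ws sw t2; apply: (map_f (fun w => (w, swd w))).
  rewrite mem_filter; apply/andP; split.
    apply: leq_trans t2; apply: uniq_leq_size; first exact: undup_uniq.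
    (* All distinct switchings of w lie in t, which has at most two elements. *)
    by move=> u; rewrite mem_undup; apply: sw.
  have cw := allP cs _ ws; have w6 := allP small _ ws.
  apply/flattenP; exists (candidates (size w)); last by apply: candidatesP => //; rewrite w6.
  apply: map_f; rewrite mem_iota ltnS w6 andbT.
  by case/andP: cw => /and3P[].
have subl (w s t : seq (seq (option bool))) : {subset w ++ s <= t} -> {subset w <= t}.
  by move=> H u uw; apply: H; rewrite mem_cat uw.
have subr (w s t : seq (seq (option bool))) : {subset w ++ s <= t} -> {subset s <= t}.
  by move=> H u uw; apply: H; rewrite mem_cat uw orbT.
have lazy (s t : seq (seq (option bool))) : {subset s <= t} -> subset_lazy s t.
  by move=> H; rewrite /subset_lazy all_lazyE; apply/allP=> u /H; rewrite mem_lazyE.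
have A1 : (a1, swd a1) \in [seq (w, swd w) | w <- small_words].
  by apply: sub_small (subl _ _ _ sub1) isT; rewrite !inE eqxx.
have A2 : (a2, swd a2) \in [seq (w, swd w) | w <- small_words].
  by apply: sub_small (subr _ _ _ sub1) isT; rewrite !inE eqxx !orbT.
have B1 : (b1, swd b1) \in [seq (w, swd w) | w <- small_words].
  by apply: sub_small (subl _ _ _ sub2) isT; rewrite !inE eqxx !orbT.
have B2 : (b2, swd b2) \in [seq (w, swd w) | w <- small_words].
  by apply: sub_small (subr _ _ _ sub2) isT; rewrite !inE eqxx !orbT.
have := check_quadruplesT; rewrite /check_quadruples all_lazyE => /allP /(_ _ A1).
rewrite all_lazyE => /allP /(_ _ B1); rewrite all_lazyE => /allP /(_ _ B2).
rewrite (lazy _ _ (subl _ _ _ sub1)) all_lazyE => /allP /(_ _ A2).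
rewrite (lazy _ _ (subr _ _ _ sub1)) (lazy _ _ sub2) /=.
have -> : perm_eq [:: a1; a2] [:: b1; b2] = false.
  by apply: contraNF nLL'; rewrite (permPl LA) (permPr LB).
suff -> : same_normal_deck [:: a1; a2] [:: b1; b2] by [].
apply: same_deck_sums_normal => F invF.
by rewrite -(deck_sum_perm _ invF LA) -(deck_sum_perm _ invF LB) sums.
Qed.

(** * Families *)

Lemma Forall2_In_l (A B : Type) (R : A -> B -> Prop) (s : list A) (t : list B) x :
  List.Forall2 R s t -> List.In x s -> exists2 y, List.In y t & R x y.
Proof.
elim=> //= a b s' t' Rab _ IH [<-|/IH[y]]; first by exists b; first by left.
by exists y; first by right.
Qed.

Lemma Forall2_In_r (A B : Type) (R : A -> B -> Prop) (s : list A) (t : list B) y :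
  List.Forall2 R s t -> List.In y t -> exists2 x, List.In x s & R x y.
Proof.
elim=> //= a b s' t' Rab _ IH [<-|/IH[x]]; first by exists a; first by left.
by exists x; first by right.
Qed.

Lemma Forall2_nth (A B : Type) (R : A -> B -> Prop) (s : seq A) (t : seq B) x y :
  List.Forall2 R s t -> size s = size t /\
  forall i, i < size s -> R (nth x s i) (nth y t i).
Proof. by elim=> //= a b s' t' Rab _ [-> IH]; split=> // -[|i] //; apply: IH. Qed.

Lemma InP (T : eqType) (x : T) s : reflect (List.In x s) (x \in s).
Proof.
elim: s => [|y s IH] /=; first by constructor.
rewrite inE; apply: (iffP orP) => [[/eqP->|/IH]|[->|/IH]]; by [left | right].
Qed.

Lemma uniq_flatten (T : eqType) (s : seq (seq T)) r r' x : uniq (flatten s) ->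
  r \in s -> r' \in s -> x \in r -> x \in r' -> r = r'.
Proof.
elim: s => //= t s IH; rewrite cat_uniq => /and3P[_ /hasPn disj us].
have out q : q \in s -> x \in q -> x \in flatten s by move=> qs xq; apply/flattenP; exists q.
rewrite !inE => /orP[/eqP->|rs] /orP[/eqP->|r's] xr xr' //.
- by have := disj _ (out _ r's xr'); rewrite xr.
- by have := disj _ (out _ rs xr); rewrite xr'.
- exact: IH.
Qed.

Lemma uniq_flatten_row (T : eqType) (s : seq (seq T)) r :
  uniq (flatten s) -> r \in s -> uniq r.
Proof.
elim: s => //= t s IH; rewrite cat_uniq inE => /and3P[ut _ us] /orP[/eqP->//|].
exact: IH.
Qed.

Definition family (row : seq (seq (seq (option bool)))) (G : digraph) : Prop :=
  exists2 e, e \in row & iso G (realize e).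

Lemma entry_canonical row e : row \in word_table -> e \in row -> all canonical e.
Proof. by move=> rt er; apply: (allP (allP table_canonical _ rt)). Qed.

Lemma entry_inj row row' e e' : row \in word_table -> row' \in word_table ->
  e \in row -> e' \in row' -> iso (realize e) (realize e') -> e = e' /\ row = row'.
Proof.
move=> rt rt' er er'.
rewrite realize_iso ?(entry_canonical rt er) ?(entry_canonical rt' er') // => /sort_lexP.
rewrite (eqP (allP (allP table_sorted _ rt) _ er)).
rewrite (eqP (allP (allP table_sorted _ rt') _ er')) => E; split=> //.
by apply: uniq_flatten table_uniq rt rt' er _; rewrite E.
Qed.

Lemma listedE (G H : digraph) : listed G H <->
  exists row e e', [/\ row \in word_table, e \in row, e' \in row, e != e' &
                       iso G (realize e) /\ iso H (realize e')].
Proof.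
split.
  case=> F [Ft [i [j [ltiF ltjF ij iG iH]]]].
  have [row rt FR] := Forall2_In_l table_codes Ft; move/InP: rt => rt.
  have [sz codesF] := Forall2_nth K1 [::] FR.
  have ltir : i < size row by rewrite -sz.
  have ltjr : j < size row by rewrite -sz.
  exists row, (nth [::] row i), (nth [::] row j); split; rewrite ?mem_nth //.
    by rewrite nth_uniq // (uniq_flatten_row table_uniq).
  have [_ ci] := codesF _ ltiF; have [_ cj] := codesF _ ltjF.
  by split; [apply: iso_trans iG ci | apply: iso_trans iH cj].
case=> row [e [e' [rt er er' ee' [iG iH]]]].
have rin : List.In row word_table by apply/InP.
have [F Ft FR] := Forall2_In_r table_codes rin.
have [sz codesF] := Forall2_nth K1 [::] FR.
have lti : index e row < size F by rewrite sz index_mem.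
have ltj : index e' row < size F by rewrite sz index_mem.
exists F; split=> //; exists (index e row), (index e' row).
have [_ ci] := codesF _ lti; have [_ cj] := codesF _ ltj.
rewrite !nth_index // in ci cj; split=> //.
- by apply: contra ee' => /eqP E; rewrite -(nth_index [::] er) E nth_index.
- by apply: iso_trans iG _; rewrite iso_sym.
- by apply: iso_trans iH _; rewrite iso_sym.
Qed.

Lemma same_deck_iso (G G' H H' : digraph) :
  iso G G' -> iso H H' -> same_deck G H -> same_deck G' H'.
Proof. by move=> iG iH same K; rewrite -(deck_mult_iso K iG) -(deck_mult_iso K iH). Qed.

Lemma entry_same_deck row e e' : row \in word_table -> e \in row -> e' \in row ->
  same_deck (realize e) (realize e').
Proof.
move=> rt er er'; apply: same_normal_deck_realize; try exact: entry_canonical rt _.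
exact: (allP (allP (allP table_decks _ rt) _ er)).
Qed.

Lemma admissible_entry row e : row \in word_table -> e \in row -> admissible (realize e).
Proof.
by move=> rt er; apply/admissible_realize/canonical_well_formed/(entry_canonical rt).
Qed.

Lemma listed_iff (G H : digraph) :
  [/\ admissible G, admissible H, ~~ iso G H & same_deck G H] <-> listed G H.
Proof.
rewrite listedE; split.
  case=> aG aH nGH same.
  have [L cL iL] := admissible_realization aG; have [M cM iM] := admissible_realization aH.
  have nLM : ~~ perm_eq L M.
    by rewrite -realize_iso //; apply: contra nGH => LM; rewrite (iso_congr iL iM).
  have /hasP[row rt /andP[Lr Mr]] :=
    same_deck_classification cL cM (same_deck_iso iL iM same) nLM.
  have sortI N : iso (realize N) (realize (sort lex_le N)).
    by apply: realize_perm; rewrite perm_sym; apply: permEl; apply: perm_sort.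
  exists row, (sort lex_le L), (sort lex_le M); split=> //.
    by apply: contra nLM => /eqP/sort_lexP.
  by split; [apply: iso_trans iL (sortI L) | apply: iso_trans iM (sortI M)].
case=> row [e [e' [rt er er' ee' [iG iH]]]].
have iG' : iso (realize e) G by rewrite iso_sym.
have iH' : iso (realize e') H by rewrite iso_sym.
split.
- exact: admissible_iso iG' (admissible_entry rt er).
- exact: admissible_iso iH' (admissible_entry rt er').
- by rewrite (iso_congr iG iH); apply: contra ee' => /(entry_inj rt rt er er')[-> _].
- exact: same_deck_iso iG' iH' (entry_same_deck rt er er').
Qed.

(** A row is a complete deck class: a further digraph with the same deck would be listed with G, and
    the rows are disjoint. *)
Lemma family_same_deck row (G H : digraph) : row \in word_table ->
  family row G -> admissible G -> admissible H -> same_deck G H -> family row H.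
Proof.
move=> rt [e er iG] aG aH same; have [GH|nGH] := boolP (iso G H).
  by exists e => //; apply: iso_trans iG; rewrite iso_sym.
have /listedE[row' [e1 [e2 [rt' e1r e2r _ [iG1 iH2]]]]] :
  listed G H by apply/listed_iff.
have [|_ ->] := entry_inj rt rt' er e1r; last by exists e2.
by apply: iso_trans iG1; rewrite iso_sym.
Qed.

Lemma family_class row : row \in word_table -> same_deck_class (family row).
Proof.
move=> rt; split.
- by move=> G H [e er iG] GH; exists e => //; apply: iso_trans iG; rewrite iso_sym.
- move=> G [e er]; rewrite iso_sym => iG.
  exact: admissible_iso iG (admissible_entry rt er).
- move=> G H [e er iG] [e' er' iH].
  by apply: same_deck_iso (entry_same_deck rt er er'); rewrite iso_sym.
have := allP table_shape _ rt; case: row rt => [|e [|e' row]] // rt _.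
have er : e \in [:: e, e' & row] by rewrite mem_head.
have er' : e' \in [:: e, e' & row] by rewrite !inE eqxx orbT.
exists (realize e), (realize e'); split.
- by exists e; last exact: iso_refl.
- by exists e'; last exact: iso_refl.
apply/negP=> /(entry_inj rt rt er er')[E _].
by have /andP[] := uniq_flatten_row table_uniq rt; rewrite E mem_head.
Qed.

Lemma family_deck_family row : row \in word_table -> deck_family (family row).
Proof.
move=> rt; have cls := family_class rt; split=> // F' cls' sub G FG.
have [H [_ [famH _ _]]] := class_nontrivial cls.
have aH := class_admissible cls famH.
apply: (family_same_deck rt famH aH (class_admissible cls' FG)).
exact: class_same_deck cls' _ _ (sub _ famH) FG.
Qed.

(** Two non-isomorphic members of F single out a row; completeness of the row puts F inside it, and
    maximality of F gives equality. *)
Lemma deck_family_family F : deck_family F ->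
  exists2 row, row \in word_table & eq_class F (family row).
Proof.
case=> cls maxF; have [G [H [FG FH nGH]]] := class_nontrivial cls.
have aG := class_admissible cls FG.
have /listedE[row [e [e' [rt er er' _ [iG iH]]]]] : listed G H.
  apply/listed_iff; split=> //; first exact: class_admissible cls _ FH.
  exact: class_same_deck cls _ _ FG FH.
have sub : sub_class F (family row).
  move=> X FX; apply: (@family_same_deck row G X) => //; first by exists e.
    exact: class_admissible cls _ FX.
  exact: class_same_deck cls _ _ FG FX.
exists row => // X; split; first exact: sub.
exact: maxF (family_class rt) sub X.
Qed.

Definition row_vertices (row : seq (seq (seq (option bool)))) :=
  sumn (map size (head [::] row)).

Lemma card_realize L : #|realize L| = sumn (map size L).
Proof. by elim: L => [|w L IH] /=; rewrite ?card_ord // card_sum card_ord -IH. Qed.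

Lemma family_of_row row : row \in word_table ->
  family_of (row_vertices row) (size row) (family row).
Proof.
move=> rt; split; first exact: family_deck_family.
  move=> G [e er /iso_card ->]; rewrite card_realize.
  by case/and3P: (allP table_shape _ rt) => _ /allP/(_ _ er)/eqP.
exists (fun i : 'I_(size row) => realize (nth [::] row i)); split.
  move=> i j /(entry_inj rt rt (mem_nth _ (ltn_ord i)) (mem_nth _ (ltn_ord j)))[/eqP + _].
  rewrite nth_uniq // ?(uniq_flatten_row table_uniq) // => /eqP.
  exact: val_inj.
move=> G; split=> [[e er iG]|[i iG]].
  have lti : index e row < size row by rewrite index_mem.
  by exists (Ordinal lti); rewrite /= nth_index // iso_sym.
by exists (nth [::] row i); rewrite ?mem_nth // iso_sym.
Qed.

(** Matching representatives of one system with those of the other is injective; used in both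
    directions, this makes the size of a class well defined. *)
Lemma class_size_le k k' F F' : eq_class F F' -> class_size k F -> class_size k' F' ->
  k <= k'.
Proof.
move=> FF' [g [injg gF]] [g' [_ gF']].
have H (i : 'I_k) : exists j, iso (g' j) (g i).
  by apply/gF'/FF'/gF; exists i; apply: iso_refl.
pose h i := [pick j | iso (g' j) (g i)].
have hP i : exists2 j, h i = Some j & iso (g' j) (g i).
  rewrite /h; case: pickP => [j ij|none]; first by exists j.
  by have [j] := H i; rewrite none.
have injh : injective h.
  move=> i j E; have [a Ea ia] := hP i; have [b Eb ib] := hP j.
  apply: injg; apply: iso_trans (_ : iso _ (g' a)) _; first by rewrite iso_sym.
  by have -> : a = b by move: E; rewrite Ea Eb => -[].
have : #|[set h i | i in 'I_k]| <= #|[set Some j | j in 'I_k']|.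
  apply: subset_leq_card; apply/subsetP=> _ /imsetP[i _ ->].
  by have [j -> _] := hP i; apply: imset_f.
rewrite !card_imset ?card_ord //; exact: Some_inj.
Qed.

Lemma family_of_unique n k F row : row \in word_table -> family_of n k F ->
  eq_class F (family row) -> n = row_vertices row /\ k = size row.
Proof.
move=> rt [_ onF szF] E; have [_ onR szR] := family_of_row rt; split.
  have [G [_ [famG _ _]]] := class_nontrivial (family_class rt).
  by rewrite -(onR _ famG) (onF G) //; apply/E.
apply/eqP; rewrite eqn_leq (class_size_le E szF szR) (@class_size_le _ _ (family row) F) //.
by move=> G; split=> /E.
Qed.

Lemma number_of_familiesE n k :
  number_of_families n k
    (size [seq row <- word_table | (row_vertices row == n) && (size row == k)]).
Proof.
set rows := filter _ _.
have rowsP row : row \in rows ->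
    [/\ row \in word_table, row_vertices row = n & size row = k].
  by rewrite mem_filter => /andP[/andP[/eqP-> /eqP->] ->].
have nthP (i : 'I_(size rows)) := rowsP _ (mem_nth [::] (ltn_ord i)).
exists (fun i => family (nth [::] rows i)); split.
- by move=> i; have [rt <- <-] := nthP i; apply: family_of_row.
- move=> i j E; have [rti _ _] := nthP i; have [rtj _ _] := nthP j.
  have [G [_ [famG _ _]]] := class_nontrivial (family_class rti).
  have [e er iG] := famG; have [e' er' iG'] := (E G).1 famG.
  have [|_ /eqP] := entry_inj rti rtj er er'; first by rewrite -(iso_congr iG (iso_refl _)).
  rewrite nth_uniq //; first by move/eqP; apply: val_inj.
  by apply: filter_uniq; vm_compute.
move=> F famF; have [row rt E] := deck_family_family (let: And3 f _ _ := famF in f).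
have [En Ek] := family_of_unique rt famF E.
have rr : row \in rows by rewrite mem_filter rt -En -Ek !eqxx.
have lti : index row rows < size rows by rewrite index_mem.
by exists (Ordinal lti); rewrite /= nth_index.
Qed.

Theorem theorem5 :
  (forall G H : digraph,
     [/\ admissible G, admissible H, ~~ iso G H & same_deck G H]
     <-> listed G H)
  /\ [/\ number_of_families 4 2 4,
         number_of_families 4 3 1,
         number_of_families 8 2 13,
         number_of_families 8 3 1
       & number_of_families 8 4 1]
  /\ (forall F : digraph -> Prop, deck_family F ->
        exists n k : nat,
          (n, k) \in [:: (4, 2); (4, 3); (8, 2); (8, 3); (8, 4)]
          /\ family_of n k F).
Proof.
split; first exact: listed_iff.
split.
  have count n k m :
      size [seq row <- word_table | (row_vertices row == n) && (size row == k)] = m ->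
      number_of_families n k m by move=> <-; apply: number_of_familiesE.
  by split; apply: count; vm_compute.
move=> F famF; have [row rt E] := deck_family_family famF.
exists (row_vertices row), (size row).
case/and3P: (allP table_shape _ rt) => _ _ shape; split=> //.
have [_ onR [g [injg gR]]] := family_of_row rt; split=> //.
  by move=> G /E; apply: onR.
by exists g; split=> // G; rewrite E.
Qed.
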